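(* Let $X=\mathbb{R}^n/\Lambda$ be a tropical torus and let $D$ be a divisor on $X$. Then $h^{0}(X,D)$ coincides with the (topological) dimension of $\Gamma(X,\mathcal{O}(D))$ as a convex polyhedron.
   Context: $\mathbb{T}=\mathbb{R}\cup\{-\infty\}$ with tropical sum $\max$ and product $+$. Tropical torus: $X=\mathbb{R}^n/\Lambda$, $\Lambda\subset\mathbb{R}^n$ a lattice of rank $n$; integral affine structure from the standard lattice $\mathbb{Z}^n$. A $\mathbb{Z}$-affine linear function is (locally) $x\mapsto a\cdot x+c$ with $a\in(\mathbb{Z}^n)^*$, $c\in\mathbb{R}$; a real-valued regular function is a continuous function that is locally a maximum of finitely many $\mathbb{Z}$-affine linear functions; a (real-valued) rational function is locally a difference of two regular functions. Divisors: a divisor $D$ on $X$ is given by local data $\{(U_i,f_i)\}$ with $\{U_i\}$ an open cover of $X$ and $f_i:U_i\to\mathbb{R}$ rational such that $f_i-f_j$ is $\mathbb{Z}$-affine linear on $U_i\cap U_j$; data $\{(U_i,f_i)\}$, $\{(V_j,g_j)\}$ define the same divisor iff all $f_i-g_j$ are $\mathbb{Z}$-affine linear on $U_i\cap V_j$. The support of $D$ is the locus where the $f_i$ are not locally affine (equivalently $D$ is the balanced weighted polyhedral complex on this locus recording slope changes). $D$ and $D'$ are linearly equivalent if $D-D'$ is the divisor of a global rational function $X\to\mathbb{R}$. A divisor is effective if it has local data consisting of regular functions. $|D|$ is the set of effective divisors linearly equivalent to $D$. A divisor passes through $p$ if $p$ is in its support. $h^0(X,D)$ is the minimum of the integers $k\ge0$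 such that there exist $k$ points $p_1,\dots,p_k\in X$ for which no $E\in|D|$ passes through all of $p_1,\dots,p_k$ (and $\infty$ if no such $k$ exists); so $h^0(X,D)=0$ iff $|D|=\emptyset$. Line bundles: let $Q:\Lambda\times\mathbb{Z}^n\to\mathbb{Z}$ be a bilinear form whose real extension $Q_{\mathbb{R}}$ to $\mathbb{R}^n\times\mathbb{R}^n$ is symmetric and let $\alpha\in(\mathbb{R}^n)^*$. $L(Q,\alpha)$ is the quotient of $\mathbb{R}^n\times\mathbb{T}$ by $\lambda\cdot(x,t)=(x+\lambda,t+Q_{\mathbb{R}}(\lambda,x)+\tfrac12Q_{\mathbb{R}}(\lambda,\lambda)+\alpha(\lambda))$, $\lambda\in\Lambda$. Every tropical line bundle on $X$ is isomorphic to some $L(Q,\alpha)$, and $L(Q,\alpha)\cong L(Q,\alpha+\gamma)$ for $\gamma\in(\mathbb{Z}^n)^*$. $\mathcal{O}(D)$ is the line bundle associated with $D$, normalized so that the local functions $f_i$ of $D$ form a rational section; thus $\mathcal{O}(D)\cong L(Q,\alpha)$ iff $D$ is the divisor induced on $X$ by a rational function $F:\mathbb{R}^n\to\mathbb{R}$ with $F(x+\lambda)=F(x)+Q_{\mathbb{R}}(\lambda,x)+\tfrac12Q_{\mathbb{R}}(\lambda,\lambda)+\alpha(\lambda)$ for all $\lambda\in\Lambda$, $x\in\mathbb{R}^n$. $\Gamma(X,L(Q,\alpha))$ is the set of regular functions $\Theta:\mathbb{R}^n\to\mathbb{R}$ satisfying this same quasi-periodicity (theta functions), together with $-\infty$.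 Polyhedral structure on $\Gamma(X,L(Q,\alpha))$: let $q:\Lambda\to(\mathbb{Z}^n)^*$, $q(\lambda)=Q(\lambda,\cdot)$, with linear extension $q_{\mathbb{R}}:\mathbb{R}^n\to(\mathbb{R}^n)^*$. If $\Gamma(X,L(Q,\alpha))\neq\{-\infty\}$, then $Q_{\mathbb{R}}$ is positive semidefinite and, up to isomorphism, $\alpha=q_{\mathbb{R}}(r)$ for some $r\in\mathbb{R}^n$. Let $B$ be a set of representatives of the finite group $(\operatorname{Im}(q_{\mathbb{R}})\cap(\mathbb{Z}^n)^* )/q(\Lambda)$; for $b\in B$ choose $c_b$ with $q_{\mathbb{R}}(c_b)=b$ and set $\Theta_b(x)=\max_{\lambda\in\Lambda}\{(b+q(\lambda))\cdot x-\tfrac12Q_{\mathbb{R}}(\lambda+c_b-r,\lambda+c_b-r)\}$, a theta function. The map $\varphi(\Theta)=(\min_{x\in\mathbb{R}^n}\{\Theta(x)-\Theta_b(x)\})_{b\in B}$ is injective on theta functions and its image $\varphi(\Gamma\setminus\{-\infty\})\subset\mathbb{R}^B$ is a convex polyhedron; the dimension of $\Gamma(X,\mathcal{O}(D))$ is the dimension of this polyhedron. If $\Gamma(X,\mathcal{O}(D))=\{-\infty\}$ its dimension is $0$. *)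

(* Defs.v *)
From HB Require Import structures.
From mathcomp Require Import all_boot all_order all_algebra.
From mathcomp Require Import all_classical all_reals all_analysis.

Set Implicit Arguments.
Unset Strict Implicit.
Unset Printing Implicit Defensive.

Import Order.TTheory GRing.Theory Num.Theory.
Import numFieldNormedType.Exports.

Local Open Scope classical_set_scope.
Local Open Scope ring_scope.
Local Open Scope quotient_scope.

(* Vectors of R^n and linear forms on R^n are both row vectors; an element of
   (Z^n)^* is an integer row vector, embedded by [zvec]. *)

Definition dot (R : realType) (n : nat) (a x : 'rV[R]_n) : R :=
  (a *m x^T) 0 0.

Definition zvec (R : realType) (n : nat) (a : 'rV[int]_n) : 'rV[R]_n :=
  map_mx intr a.

Section AffineStructure.
Context {R : realType} {n : nat}.
Implicit Types (f g h : 'rV[R]_n -> R) (W V : set 'rV[R]_n).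

Definition zaffine (p : 'rV[int]_n * R) (x : 'rV[R]_n) : R :=
  dot (zvec R p.1) x + p.2.

Definition zaffine_near f (x : 'rV[R]_n) : Prop :=
  exists p, \forall y \near x, f y = zaffine p y.

Definition zaffine_on W f : Prop := forall x, W x -> zaffine_near f x.

(* The maximum is over the nonempty family p :: s.  Continuity of f at every
   point of W follows from the local formula. *)
Definition regular_on W f : Prop :=
  forall x, W x -> exists (p : 'rV[int]_n * R) (s : seq ('rV[int]_n * R)),
    \forall y \near x,
      f y = \big[Num.max/zaffine p y]_(q <- s) zaffine q y.

Definition rational_on W f : Prop :=
  forall x, W x -> exists V g h,
    [/\ open V, V x, regular_on V g, regular_on V h
      & forall y, V y -> f y = g y - h y].

End AffineStructure.

(* The lattice spanned over Z by the rows of M; it has rank n when M is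
   invertible. *)
Definition lattice (R : realType) (n : nat) (M : 'M[R]_n) : set 'rV[R]_n :=
  [set zvec R k *m M | k in [set: 'rV[int]_n]].

Definition lattice_rel (R : realType) (n : nat) (M : 'M[R]_n) :
    rel 'rV[R]_n :=
  fun x y => `[< lattice M (y - x) >].

Lemma lattice_rel_equiv (R : realType) (n : nat) (M : 'M[R]_n) :
  equiv_class_of (lattice_rel M).
Proof.
split=> [x|x y|y x z].
- by apply/asboolP; exists 0 => //; rewrite /zvec map_mx0 mul0mx subrr.
- apply/asboolP/asboolP => -[k _ kE]; exists (- k) => //.
    by rewrite /zvec map_mxN mulNmx kE opprB.
  by rewrite /zvec map_mxN mulNmx kE opprB.
- move=> /asboolP[k _ kE] /asboolP[l _ lE]; apply/asboolP; exists (k + l) => //.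
  by rewrite /zvec map_mxD mulmxDl kE lE addrC subrKA.
Qed.

Canonical lattice_equiv (R : realType) (n : nat) (M : 'M[R]_n) :=
  EquivRelPack (lattice_rel_equiv M).

Definition torus (R : realType) (n : nat) (M : 'M[R]_n) :=
  quotient_topology {eq_quot lattice_equiv M}.

Definition torus_proj (R : realType) (n : nat) (M : 'M[R]_n) (x : 'rV[R]_n) :
    torus M :=
  \pi_(torus M) x.

Section Divisors.
Context {R : realType} {n : nat} (M : 'M[R]_n).
Local Notation X := (torus M).

(* The projection is a local isomorphism of integral affine manifolds, so the
   local notions on X are tested after composition with it. *)
Definition torus_zaffine_on (U : set X) (f : X -> R) : Prop :=
  zaffine_on (torus_proj M @^-1` U) (f \o torus_proj M).

Definition torus_regular_on (U : set X) (f : X -> R) : Prop :=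
  regular_on (torus_proj M @^-1` U) (f \o torus_proj M).

Definition torus_rational_on (U : set X) (f : X -> R) : Prop :=
  rational_on (torus_proj M @^-1` U) (f \o torus_proj M).

(* Only the values of [fn i] on [dom i] are relevant. *)
Record local_data := LocalData {
  idx : Type;
  dom : idx -> set X;
  fn : idx -> X -> R }.

Definition is_divisor (D : local_data) : Prop :=
  [/\ forall i : idx D, open (dom i),
      forall p : X, exists i : idx D, dom i p,
      forall i : idx D, torus_rational_on (dom i) (fn i)
    & forall i j : idx D,
        torus_zaffine_on (dom i `&` dom j) (fun p => fn i p - fn j p)].

Definition same_divisor (D E : local_data) : Prop :=
  forall (i : idx D) (j : idx E),
    torus_zaffine_on (dom i `&` dom j) (fun p => fn i p - fn j p).

Definition sub_data (D E : local_data) : local_data :=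
  @LocalData (idx D * idx E)%type
    (fun ij => dom ij.1 `&` dom ij.2)
    (fun ij p => fn ij.1 p - fn ij.2 p).

Definition div_of (h : X -> R) : local_data :=
  @LocalData unit (fun=> setT) (fun=> h).

Definition lin_equiv (D E : local_data) : Prop :=
  exists2 h : X -> R, torus_rational_on setT h
    & same_divisor (sub_data D E) (div_of h).

Definition effective (D : local_data) : Prop :=
  exists E : local_data,
    [/\ is_divisor E, same_divisor D E
      & forall i : idx E, torus_regular_on (dom i) (fn i)].

Definition complete_linear_system (D E : local_data) : Prop :=
  [/\ is_divisor E, effective E & lin_equiv E D].

Definition div_support (D : local_data) : set X :=
  [set p | exists i : idx D, dom i p /\
     ~ exists U : set X, [/\ open U, U p & torus_zaffine_on U (fn i)]].

(* The points need not be distinct; dropping repetitions does not change the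
   minimum below. *)
Definition avoidable (D : local_data) (k : nat) : Prop :=
  exists p : 'I_k -> X, forall E : local_data,
    complete_linear_system D E -> ~ (forall i, div_support E (p i)).

Lemma ex_avoidableb (D : local_data) :
  (exists k, avoidable D k) -> exists k, `[< avoidable D k >].
Proof. by case=> k Hk; exists k; apply/asboolP. Qed.

(* [None] stands for infinity. *)
Definition h0 (D : local_data) : option nat :=
  match pselect (exists k, avoidable D k) with
  | left ex => Some (ex_minn (ex_avoidableb ex))
  | right _ => None
  end.

End Divisors.

Section ThetaFunctions.
Context {R : realType} {n : nat} (M : 'M[R]_n).
Implicit Types (A : 'M[R]_n) (alpha r : 'rV[R]_n).

(* A is the Gram matrix of the real extension of Q in the standard basis:
   Q_R(x, y) = x A y^T and q_R(x) = x A. *)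
Definition Qform A (x y : 'rV[R]_n) : R := dot (x *m A) y.

(* Since M is invertible, a bilinear form Lambda x Z^n -> Z is the same as a
   real bilinear form that is integral on Lambda x Z^n. *)
Definition is_form A : Prop :=
  (forall x y, Qform A x y = Qform A y x) /\
  (forall (l : 'rV[R]_n) (m : 'rV[int]_n), lattice M l ->
     exists z : int, Qform A l (zvec R m) = z%:~R).

Definition quasi_periodic A alpha (F : 'rV[R]_n -> R) : Prop :=
  forall l x, lattice M l ->
    F (x + l) = F x + Qform A l x + 2^-1 * Qform A l l + dot alpha l.

(* O(D) is isomorphic to L(Q, alpha): the pullback of D to R^n is the divisor
   of a quasi-periodic rational function. *)
Definition bundle_iso (D : local_data M) A alpha : Prop :=
  exists F : 'rV[R]_n -> R,
    [/\ rational_on setT F, quasi_periodic A alpha F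
      & forall i : idx D, zaffine_on (torus_proj M @^-1` dom i)
          (fun x => F x - fn i (torus_proj M x))].

(* The elements of Gamma(X, L(Q, alpha)) other than -oo. *)
Definition theta A alpha : set ('rV[R]_n -> R) :=
  [set T | regular_on setT T /\ quasi_periodic A alpha T].

(* B lists, without repetition, representatives of
   (Im q_R /\ (Z^n)^* ) / q(Lambda). *)
Definition is_representatives A (m : nat) (B : 'I_m -> 'rV[int]_n) : Prop :=
  (forall j, exists c, c *m A = zvec R (B j)) /\
  (forall v : 'rV[int]_n, (exists c, c *m A = zvec R v) ->
     exists! j : 'I_m, exists2 l, lattice M l
       & zvec R v = zvec R (B j) + l *m A).

(* For Q_R positive semidefinite, the supremum is attained. *)
Definition theta_basis A r (b : 'rV[int]_n) (c x : 'rV[R]_n) : R :=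
  sup [set dot (zvec R b + l *m A) x
           - 2^-1 * Qform A (l + c - r) (l + c - r) | l in lattice M].

(* The difference is a continuous function on the compact torus when T is a
   theta function, so the infimum is a minimum. *)
Definition theta_coord A r (m : nat) (B : 'I_m -> 'rV[int]_n)
    (c : 'I_m -> 'rV[R]_n) (T : 'rV[R]_n -> R) : 'rV[R]_m :=
  \row_j inf [set T x - theta_basis A r (B j) (c j) x | x in setT].

End ThetaFunctions.

Definition has_independent_points (R : realType) (m : nat)
    (S : set 'rV[R]_m) (d : nat) : Prop :=
  exists (x : 'rV[R]_m) (P : 'M[R]_(d, m)),
    [/\ S x, row_free P & forall i, S (x + row i P)].

(* Dimension of the affine hull: the largest d such that S contains d + 1
   affinely independent points. *)
Definition affine_dim (R : realType) (m : nat) (S : set 'rV[R]_m) : nat :=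
  (\max_(d < m.+1 | `[< has_independent_points S d >]) d)%N.

(* d is the dimension of Gamma(X, O(D)), computed from some presentation
   L(Q, alpha) of O(D) with, when Gamma is not {-oo}, alpha = q_R(r). *)
Definition dim_Gamma (R : realType) (n : nat) (M : 'M[R]_n)
    (D : local_data M) (d : nat) : Prop :=
  exists (A : 'M[R]_n) (alpha : 'rV[R]_n),
    [/\ is_form M A, bundle_iso D A alpha
      & (theta M A alpha = set0 /\ d = 0%N) \/
        (theta M A alpha !=set0 /\
         exists (r : 'rV[R]_n) (m : nat) (B : 'I_m -> 'rV[int]_n)
                (c : 'I_m -> 'rV[R]_n),
           [/\ alpha = r *m A, is_representatives M A B,
               forall j, c j *m A = zvec R (B j)
             & d = affine_dim (theta_coord M A r B c @` theta M A alpha)])].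

(* Main.v *)
(* Pulled back to R^n, a divisor D is the divisor of a single rational function
   F, because H^1(R^n, Z^n x R) = 0; the differences F(x + l) - F(x) are affine
   and yield (Q, alpha).  Then |D| is the set of divisors of theta functions, and
   D' in |D| passes through a point iff its theta function is not affine there.
   A function is regular on R^n iff it has an integer subgradient at each point,
   and this shows that every theta function is max_b (t_b + Theta_b), with t_b
   the b-th coordinate of phi.  Both numbers equal |B| whenever theta functions
   exist:
   - fewer than |B| points: a tropical linear dependence between the vectors
     (Theta_b(p_i))_i gives t with the maximum attained twice at every p_i, by
     two Theta_b having distinct slopes;
   - near a generic point all the Theta_b are affine with distinct slopes, so on
     a short generic segment max_b (t_b + Theta_b) is a maximum of |B| lines with
     distinct slopes, which has at most |B| - 1 corners: |B| points of the segment
     cannot all lie on an effective divisor;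
   - for suitable t every line is strictly dominant somewhere on this segment, so
     that phi maps onto a neighbourhood of t. *)

Require Import Defs.
From mathcomp Require Import all_boot all_order all_algebra.
From mathcomp Require Import perm.
From mathcomp Require Import all_classical all_reals all_analysis.
From mathcomp Require Import ring lra zify.
Set Implicit Arguments.
Unset Strict Implicit.
Unset Printing Implicit Defensive.
Import Order.TTheory GRing.Theory Num.Theory.
Import numFieldNormedType.Exports.
Local Open Scope classical_set_scope.
Local Open Scope ring_scope.

(** * Dot product and continuation along segments *)

Lemma nearPnorm (R : realType) (V : normedModType R) (x : V) (P : V -> Prop) :
  (\forall y \near x, P y) <->
  exists2 e : R, 0 < e & forall y, `|y - x| < e -> P y.
Proof.
rewrite nbhs_normP; split => -[e e0 eP]; exists e => // y ye; apply: eP => /=.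
- by rewrite distrC.
- by rewrite distrC; exact: ye.
Qed.

Section Dot.
Context {R : realType} {n : nat}.
Implicit Types (a b x y : 'rV[R]_n).

Lemma dotE a x : dot a x = \sum_i a 0 i * x 0 i.
Proof. by rewrite /dot mxE; apply: eq_bigr => i _; rewrite mxE. Qed.

Lemma dotC a x : dot a x = dot x a.
Proof. by rewrite !dotE; apply: eq_bigr => i _; rewrite mulrC. Qed.

Lemma dotDl a b x : dot (a + b) x = dot a x + dot b x.
Proof. by rewrite /dot mulmxDl mxE. Qed.

Lemma dotNl a x : dot (- a) x = - dot a x.
Proof. by rewrite /dot mulNmx mxE. Qed.

Lemma dotZl k a x : dot (k *: a) x = k * dot a x.
Proof. by rewrite /dot -scalemxAl mxE. Qed.

Lemma dotBl a b x : dot (a - b) x = dot a x - dot b x.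
Proof. by rewrite dotDl dotNl. Qed.

Lemma dot0l x : dot 0 x = 0.
Proof. by rewrite /dot mul0mx mxE. Qed.

Lemma dotDr a x y : dot a (x + y) = dot a x + dot a y.
Proof. by rewrite !(dotC a) dotDl. Qed.

Lemma dotNr a x : dot a (- x) = - dot a x.
Proof. by rewrite !(dotC a) dotNl. Qed.

Lemma dotZr k a x : dot a (k *: x) = k * dot a x.
Proof. by rewrite !(dotC a) dotZl. Qed.

Lemma dotBr a x y : dot a (x - y) = dot a x - dot a y.
Proof. by rewrite dotDr dotNr. Qed.

Lemma dot0r a : dot a 0 = 0.
Proof. by rewrite dotC dot0l. Qed.

Definition dot_lin := (dotDl, dotDr, dotNl, dotNr, dotZl, dotZr, dot0l, dot0r).

Lemma dot_delta a i : dot a (delta_mx 0 i) = a 0 i.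
Proof.
rewrite dotE (bigD1 i) //= !mxE !eqxx mulr1 big1 ?addr0 // => j jNi.
by rewrite !mxE (negbTE jNi) andbF mulr0.
Qed.

Lemma dot_ge0 a : 0 <= dot a a.
Proof. by rewrite dotE; apply: sumr_ge0 => i _; rewrite -expr2 sqr_ge0. Qed.

Lemma dot_mulmx (A : 'M[R]_n) x y : dot (x *m A) y = dot x (y *m A^T).
Proof. by rewrite /dot trmx_mul trmxK mulmxA. Qed.

Lemma normr_entry x i : `|x 0 i| <= `|x|.
Proof.
rewrite [X in _ <= X]mx_normrE.
exact: (le_bigmax _ (fun ij => `|x ij.1 ij.2|) (0, i)).
Qed.

Lemma normr_rV_le x e : 0 <= e -> (forall i, `|x 0 i| <= e) -> `|x| <= e.
Proof.
move=> e0 xe; rewrite [X in X <= _]mx_normrE.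
by apply/bigmax_leP; split=> // -[i j] _ /=; rewrite (ord1 i).
Qed.

Lemma normr_delta_le1 i : `|delta_mx 0 i : 'rV[R]_n| <= 1.
Proof.
apply: normr_rV_le => // j; rewrite mxE.
by case: (_ && _); rewrite ?normr1 ?normr0.
Qed.

Lemma normr_dot_le a x : `|dot a x| <= n%:R * `|a| * `|x|.
Proof.
rewrite dotE (le_trans (ler_norm_sum _ _ _)) //.
apply: (@le_trans _ _ (\sum_(i < n) `|a| * `|x|)).
  by apply: ler_sum => i _; rewrite normrM ler_pM // normr_entry.
by rewrite sumr_const card_ord -mulrA mulr_natl.
Qed.

End Dot.

Section Zvec.
Context {R : realType} {n : nat}.
Implicit Types (a b : 'rV[int]_n).

Lemma zvecE a i : zvec R a 0 i = (a 0 i)%:~R.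
Proof. by rewrite mxE. Qed.

Lemma zvecD a b : zvec R (a + b) = zvec R a + zvec R b.
Proof. by rewrite /zvec map_mxD. Qed.

Lemma zvecN a : zvec R (- a) = - zvec R a.
Proof. by rewrite /zvec map_mxN. Qed.

Lemma zvecB a b : zvec R (a - b) = zvec R a - zvec R b.
Proof. by rewrite zvecD zvecN. Qed.

Lemma zvec0 : zvec R 0 = 0 :> 'rV[R]_n.
Proof. by rewrite /zvec map_mx0. Qed.

Lemma zvec_inj : injective (@zvec R n).
Proof.
move=> a b ab; apply/rowP => i.
by have := congr1 (fun v : 'rV[R]_n => v 0 i) ab; rewrite !zvecE => /intr_inj.
Qed.

Lemma zaffineD (p q : 'rV[int]_n * R) x :
  zaffine (p + q) x = zaffine p x + zaffine q x.
Proof. by rewrite /zaffine /= zvecD dotDl addrACA. Qed.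

Lemma zaffineN (p : 'rV[int]_n * R) x : zaffine (- p) x = - zaffine p x.
Proof. by rewrite /zaffine /= zvecN dotNl opprD. Qed.

Lemma zaffineB (p q : 'rV[int]_n * R) x :
  zaffine (p - q) x = zaffine p x - zaffine q x.
Proof. by rewrite zaffineD zaffineN. Qed.

Lemma zaffine0 x : zaffine (0 : 'rV[int]_n * R) x = 0.
Proof. by rewrite /zaffine /= zvec0 dot0l addr0. Qed.

Lemma zaffine_shift (p : 'rV[int]_n * R) x l :
  zaffine p (x + l) = zaffine (p.1, p.2 + dot (zvec R p.1) l) x.
Proof. by rewrite /zaffine /= dotDr; ring. Qed.

(** The values at [x] and at the points [x + (e / 2) e_i] determine the slope, then the constant.
    Affine germs can thus be compared as elements of a group. *)
Lemma zaffine_near_inj (p q : 'rV[int]_n * R) (x : 'rV[R]_n) :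
  (\forall y \near x, zaffine p y = zaffine q y) -> p = q.
Proof.
move=> /nearPnorm[e e0 pq].
have E0 := pq x; rewrite subrr normr0 in E0; move: (E0 e0) => {}E0.
have p1 : p.1 = q.1.
  apply/rowP => i; apply: (@intr_inj R); rewrite -!zvecE -!dot_delta.
  have := pq (x + (e / 2) *: delta_mx 0 i).
  rewrite addrAC subrr add0r => /(_ _).
  have -> : `|(e / 2) *: delta_mx 0 i : 'rV[R]_n| < e.
    rewrite normrZ gtr0_norm; last by lra.
    by have := normr_delta_le1 (R := R) i; nra.
  move/(_ isT); rewrite /zaffine !dot_lin in E0 *; move => E1.
  have e2 : e / 2 != 0 by lra.
  by apply: (mulfI e2); lra.
by move: p q p1 E0 {pq} => [p1 p2] [q1 q2] /= ->; rewrite /zaffine /= => /addrI ->.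
Qed.

End Zvec.

(** * Continuation along segments *)

Section Connectedness.
Context {R : realType}.

(** Connectedness of [[0, 1]]: local propagation carries [P] past the supremum of the set where it
    holds, unless 1 is already within reach. *)
Lemma real_induction (P : R -> Prop) :
  (forall t, 0 <= t <= 1 -> exists2 e : R, 0 < e &
     forall s s', 0 <= s <= 1 -> 0 <= s' <= 1 ->
       `|s - t| < e -> `|s' - t| < e -> P s -> P s') ->
  P 0 -> P 1.
Proof.
move=> Ploc P0.
pose S := [set t | 0 <= t <= 1 /\ P t].
have S0 : S 0 by split; rewrite // lexx ler01.
have hS : has_sup S by split; [exists 0|exists 1 => t [/andP[]]].
have Sge0 : 0 <= sup S by apply: ub_le_sup; [exact: hS.2|].
have S1 : sup S <= 1 by apply: ge_sup; [exists 0|move=> t [/andP[]]].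
have [|e e0 eP] := Ploc (sup S); first by rewrite Sge0.
have [s [/andP[s0 s1] Ps] se] := sup_adherent e0 hS.
have sS : s <= sup S by apply: ub_le_sup; [exact: hS.2|split; rewrite // s0].
have [T1|T1] := leP 1 (sup S + e / 2).
  apply: (eP s) => //; rewrite ?s0 ?ler01 ?lexx //.
    by rewrite ltr_norml; apply/andP; split; lra.
  by rewrite ltr_norml; apply/andP; split; lra.
have PT : P (sup S + e / 2).
  apply: (eP s) => //; rewrite ?s0 // ?ltr_norml; apply/andP; split; lra.
have : sup S + e / 2 <= sup S.
  apply: ub_le_sup; first exact: hS.2.
  by split=> //; apply/andP; split; lra.
by lra.
Qed.

Lemma near_segment (V : normedModType R) (x y : V) (t : R) (P : V -> Prop) :
  (\forall z \near x + t *: (y - x), P z) ->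
  exists2 e : R, 0 < e & forall s, `|s - t| < e -> P (x + s *: (y - x)).
Proof.
move=> /nearPnorm[e e0 eP].
have d0 : 0 < `|y - x| + 1 by rewrite ltr_wpDl.
exists (e / (`|y - x| + 1)); first exact: divr_gt0.
move=> s se; apply: eP; rewrite opprD addrACA subrr add0r -scalerBl normrZ.
rewrite ltr_pdivlMr // in se; apply: le_lt_trans se.
by rewrite ler_wpM2l // lerDl.
Qed.

Lemma locally_invariant_global (V : normedModType R) (P : V -> Prop) :
  (forall x, \forall y \near x, P y <-> P x) -> forall x y, P x -> P y.
Proof.
move=> Ploc x y Px.
rewrite -[y](subrK x) addrC -[y - x]scale1r.
apply: (@real_induction (fun t => P (x + t *: (y - x)))).
- move=> t _; have [e e0 eP] := near_segment (Ploc (x + t *: (y - x))).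
  by exists e => // s s' _ _ /eP es /eP es' /es /es'.
- by rewrite scale0r addr0.
Qed.

Lemma locally_constant_global (V : normedModType R) (T : Type) (g : V -> T) :
  (forall x, \forall y \near x, g y = g x) -> forall x y, g x = g y.
Proof.
move=> gloc x y; apply: (@locally_invariant_global V (fun z => g x = g z)) => //.
by move=> z; apply: filterS (gloc z) => w ->.
Qed.

End Connectedness.

(* Vanishing of H^1(V, G) for a constant sheaf G on a normed space V: the
   family [s] represents a 1-cocycle, and a section compatible with it is
   obtained by continuation along the segments [0, x]. *)
Section TorsorTrivial.
Context {R : realType} {V : normedModType R} {G : zmodType} {I : Type}.
Variables (U : I -> set V) (s : I -> V -> G).
Hypothesis U_open : forall i, open (U i).
Hypothesis U_cover : forall x, exists i, U i x.
Hypothesis s_loc : forall i j x, U i x -> U j x ->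
  \forall y \near x, s i y - s j y = s i x - s j x.

Let compat_path (x : V) (g : R -> G) (t : R) : Prop := forall i, U i (t *: x) ->
  exists2 e : R, 0 < e & forall v, `|v - t| < e ->
    g v - s i (v *: x) = g t - s i (t *: x).

Let near_ray (x : V) (t : R) (P : V -> Prop) :
  (\forall z \near t *: x, P z) ->
  exists2 e : R, 0 < e & forall v, `|v - t| < e -> P (v *: x).
Proof.
move=> tP; have := @near_segment R V 0 x t P; rewrite add0r subr0 => /(_ tP).
by move=> [e e0 eP]; exists e => // v /eP; rewrite add0r.
Qed.

(** By continuation on the length of the interval [[0, t]] that carries a compatible path; inside
    one chart [i] the path is prolonged by [s i] up to a constant. *)
Lemma path_exists (x : V) : exists g : R -> G,
  g 0 = 0 /\ forall t, 0 <= t <= 1 -> compat_path x g t.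
Proof.
apply: (@real_induction R (fun t => exists g : R -> G,
  g 0 = 0 /\ forall u : R, 0 <= u <= t -> compat_path x g u)); last first.
  have [i U0] := U_cover (0 *: x).
  exists (fun v : R => s i (v *: x) - s i 0); rewrite scale0r subrr; split=> // u.
  move=> /le_anti <- j Uj.
  have [e e0 eP] := near_ray (s_loc U0 Uj).
  by exists e => // v /eP; rewrite scale0r => E; rewrite addrAC E addrAC.
move=> t _; have [i Ui] := U_cover (t *: x).
have [e e0 eP] := near_ray (open_nbhs_nbhs (conj (U_open i) Ui)).
exists e => // u u' _ _ ue ue' [g [g0 gP]].
have [uu'|uu'] := leP u' u.
  by exists g; split=> // v /andP[v0 vu]; apply: gP; rewrite v0 (le_trans vu).
(* For [u < 0] the compatibility of [g] is an empty condition. If moreover [0 <= u'], then 0 lies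
   between [u] and [u'], so chart [i] contains the origin and a path can start there. *)
have [u0|u0] := ltP u 0.
  have [u'0|u'0] := ltP u' 0.
    by exists g; split=> // v /andP[v0 vu]; lra.
  have U0 : U i 0.
    rewrite -(scale0r x); apply: eP; move: ue ue'.
    by rewrite !ltr_norml => /andP[? ?] /andP[? ?]; apply/andP; split; lra.
  exists (fun v : R => s i (v *: x) - s i 0); rewrite scale0r subrr; split=> // v.
  move=> /andP[v0 vu'] j Uj.
  have Uv : U i (v *: x).
    apply: eP; move: ue ue'.
    by rewrite !ltr_norml => /andP[? ?] /andP[? ?]; apply/andP; split; lra.
  have [d d0 dP] := near_ray (s_loc Uv Uj).
  by exists d => // w /dP E; rewrite addrAC E addrAC.
pose h (v : R) := if v <= u then g v else g u - s i (u *: x) + s i (v *: x).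
have hu (v : R) : u <= v -> h v = g u - s i (u *: x) + s i (v *: x).
  by rewrite /h; case: (ltgtP v u) => [//|//|-> _]; rewrite subrK.
have Uu : U i (u *: x) by apply: eP.
have gu : compat_path x g u by apply: gP; rewrite u0 lexx.
exists h; split; first by rewrite /h u0.
move=> v /andP[v0 vu'] j Uj.
have [vu|uv|vu] := ltgtP v u.
- have [|d d0 dP] := gP v _ j Uj; first by rewrite v0 ltW.
  exists (Num.min d (u - v)); first by rewrite lt_min d0 subr_gt0.
  move=> w; rewrite lt_min => /andP[/dP wE wv].
  have wu : w <= u by move: wv; rewrite ltr_norml => /andP[? ?]; lra.
  by rewrite /h wu (ltW vu).
- have Uv : U i (v *: x).
    apply: eP; move: ue ue'.
    by rewrite !ltr_norml => /andP[? ?] /andP[? ?]; apply/andP; split; lra.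
  have [d d0 dP] := near_ray (s_loc Uv Uj).
  exists (Num.min d (v - u)); first by rewrite lt_min d0 subr_gt0.
  move=> w; rewrite lt_min => /andP[/dP wE wv].
  have uw : u <= w by move: wv; rewrite ltr_norml => /andP[? ?]; lra.
  by rewrite !hu ?(ltW vu) ?(ltW uv) // -!(addrA (_ - _)) wE.
- move: Uj; rewrite vu => Uj.
  have [d d0 dP] := near_ray (s_loc Uu Uj).
  have [d' d'0 dP'] := gu j Uj.
  exists (Num.min d d'); first by rewrite lt_min d0.
  move=> w; rewrite lt_min => /andP[/dP wE /dP' wE'].
  have [wu|uw] := leP w u; first by rewrite /h wu lexx wE'.
  by rewrite !hu ?lexx ?(ltW uw) // -!(addrA (_ - _)) wE.
Qed.

(** The section takes at [x] the end value of the path along [[0, x]]. Its compatibility under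
    variation of [x] is carried from [t = 0] to [t = 1] by a second continuation. *)
Lemma torsor_trivial : exists g : V -> G, forall i x, U i x ->
  \forall y \near x, g y - s i y = g x - s i x.
Proof.
have [g gP] := choice path_exists.
have g0 y : g y 0 = 0 by case: (gP y).
have {}gP y (t : R) : 0 <= t <= 1 -> compat_path y (g y) t by case: (gP y) => _; apply.
pose P (x : V) (t : R) := forall i, U i (t *: x) ->
  \forall y \near x, g y t - s i (t *: y) = g x t - s i (t *: x).
suff P1 x : P x 1.
  exists (fun x => g x 1) => i x Ui.
  have := P1 x i; rewrite scale1r => /(_ Ui).
  by apply: filterS => y; rewrite scale1r.
apply: (@real_induction R (P x)); last first.
  by move=> i _; apply: filterE => y; rewrite !g0 !scale0r.
move=> t t01; have [i Ui] := U_cover (t *: x).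
have /nearPnorm[r r0 rU] := open_nbhs_nbhs (conj (U_open i) Ui).
have x1 : 0 < `|x| + 1 by rewrite ltr_wpDl.
exists (r / 2 / (`|x| + 1)) => [|u u' u01 u'01 ut u't Pu j Uj].
  by rewrite !divr_gt0.
(* A whole tube around the segment lies in chart [i]: both [v |y - x|] and [|v - t| |x|] are below
   [r / 2]. *)
have tube (v : R) (y : V) : 0 <= v <= 1 -> `|v - t| < r / 2 / (`|x| + 1) ->
    `|y - x| < r / 2 -> U i (v *: y).
  move=> /andP[v0 v1] vt yx; apply: rU.
  have -> : v *: y - t *: x = v *: (y - x) + (v - t) *: x.
    by rewrite scalerBr scalerBl addrA subrK.
  rewrite (le_lt_trans (ler_normD _ _)) // !normrZ (ger0_norm v0).
  rewrite ltr_pdivlMr // in vt; have := normr_ge0 (y - x).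
  have := normr_ge0 x; have := normr_ge0 (v - t); nra.
have const (y : V) : `|y - x| < r / 2 ->
    g y u' - s i (u' *: y) = g y u - s i (u *: y).
  move=> yx.
  pose c (z : R) := u + z * (u' - u).
  have c01 (z : R) : 0 <= z <= 1 -> 0 <= c z <= 1.
    rewrite /c; move: u01 u'01 => /andP[? ?] /andP[? ?] /andP[? ?].
    by apply/andP; split; nra.
  have ct (z : R) : 0 <= z <= 1 -> `|c z - t| < r / 2 / (`|x| + 1).
    move: ut u't; rewrite /c; set d := _ / (_ + 1).
    rewrite !ltr_norml => /andP[? ?] /andP[? ?] /andP[? ?].
    have [uu'|uu'] := leP u u'.
      have : 0 <= z * (u' - u) <= u' - u by apply/andP; split; nra.
      by move=> /andP[? ?]; apply/andP; split; lra.
    have : u' - u <= z * (u' - u) <= 0 by apply/andP; split; nra.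
    by move=> /andP[? ?]; apply/andP; split; lra.
  have -> : u' = c 1 by rewrite /c; ring.
  apply: (@real_induction R (fun z =>
    g y (c z) - s i (c z *: y) = g y u - s i (u *: y))); last first.
    by have -> : c 0 = u by rewrite /c; ring.
  move=> z z01; have Ui_z := tube _ _ (c01 _ z01) (ct _ z01) yx.
  have [d d0 dP] := gP y _ (c01 _ z01) _ Ui_z.
  have uu0 : 0 < `|u' - u| + 1 by rewrite ltr_wpDl.
  exists (d / (`|u' - u| + 1)); first by rewrite divr_gt0.
  have czd (w : R) : `|w - z| < d / (`|u' - u| + 1) -> `|c w - c z| < d.
    rewrite ltr_pdivlMr // => wz.
    have -> : c w - c z = (w - z) * (u' - u) by rewrite /c; ring.
    by rewrite normrM; apply: le_lt_trans wz; rewrite ler_wpM2l // lerDl.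
  by move=> w w' _ _ /czd /dP wz /czd /dP w'z <-; rewrite w'z wz.
have Uu : U i (u *: x) by apply: tube => //; rewrite subrr normr0 divr_gt0.
have Uu' : U i (u' *: x) by apply: tube => //; rewrite subrr normr0 divr_gt0.
have r20 : 0 < r / 2 by rewrite divr_gt0.
have near_ball : \forall y \near x, `|y - x| < r / 2.
  by apply/nearPnorm; exists (r / 2).
have near_s : \forall y \near x,
    s i (u' *: y) - s j (u' *: y) = s i (u' *: x) - s j (u' *: x).
  have /nearPnorm[d d0 dP] := s_loc Uu' Uj.
  apply/nearPnorm; exists d => // y yx; apply: dP.
  move: u'01 => /andP[u'0 u'1].
  rewrite -scalerBr normrZ ger0_norm //; apply: le_lt_trans yx.
  by rewrite ler_piMl.
have xx : `|x - x| < r / 2 by rewrite subrr normr0.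
near=> y.
have yx : `|y - x| < r / 2 by near: y.
have E1 : g y u - s i (u *: y) = g x u - s i (u *: x).
  by near: y; exact: Pu.
have E2 : s i (u' *: y) - s j (u' *: y) = s i (u' *: x) - s j (u' *: x).
  by near: y.
rewrite -[LHS](subrKA (s i (u' *: y))) E2 const // E1 -const //.
by rewrite subrKA.
Unshelve. all: by end_near. Qed.

End TorsorTrivial.

(** * Regular functions and integer subgradients *)

Section Regular.
Context {R : realType} {n : nat}.
Implicit Types (f g : 'rV[R]_n -> R) (x y : 'rV[R]_n) (p q : 'rV[int]_n * R).

Definition is_max_at (s : seq ('rV[int]_n * R)) f y : Prop :=
  (forall q, q \in s -> zaffine q y <= f y) /\
  exists2 q, q \in s & f y = zaffine q y.

Lemma bigmax_is_max p s y :
  is_max_at (p :: s) (fun z => \big[Num.max/zaffine p z]_(q <- s) zaffine q z) y.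
Proof.
elim: s => [|r s [IHle [q qs qE]]].
  rewrite /is_max_at big_nil; split; last by exists p; rewrite ?inE.
  by move=> q; rewrite inE => /eqP ->.
rewrite /is_max_at big_cons; split=> [q'|].
  rewrite !inE => /or3P[/eqP->|/eqP->|q's]; rewrite le_max ?lexx //.
    by rewrite IHle ?orbT // inE eqxx.
  by rewrite IHle ?orbT // inE q's orbT.
rewrite qE; case: (leP (zaffine r y) (zaffine q y)) => _; last first.
  by exists r => //; rewrite !inE eqxx orbT.
by exists q => //; move: qs; rewrite !inE => /orP[->|->]; rewrite ?orbT.
Qed.

Lemma regular_onP W f : regular_on W f <->
  forall x, W x -> exists s, \forall y \near x, is_max_at s f y.
Proof.
split=> fr x /fr; last first.
  move=> [s fs]; have [_ [p ps _]] := nbhs_singleton fs.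
  exists p, s; apply: filterS fs => y [fle [q qs fE]].
  have [ble [r rps bE]] := bigmax_is_max p s y.
  apply/eqP; rewrite eq_le; apply/andP; split.
    by rewrite fE ble // inE qs orbT.
  by rewrite bE fle //; move: rps; rewrite inE => /orP[/eqP ->|].
move=> [p [s fE]]; exists (p :: s); apply: filterS fE => y fE.
by have := bigmax_is_max p s y; rewrite /is_max_at fE.
Qed.

Lemma zaffine_lipschitz p x y :
  zaffine p y - zaffine p x <= n%:R * `|zvec R p.1| * `|y - x|.
Proof.
apply: le_trans (normr_dot_le _ _); apply: le_trans (ler_norm _).
by rewrite le_eqVlt /zaffine dotBr; apply/orP; left; apply/eqP; ring.
Qed.

Lemma zaffines_lipschitz (s : seq ('rV[int]_n * R)) :
  exists2 L : R, 0 <= L & forall q x y, q \in s ->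
    zaffine q y - zaffine q x <= L * `|y - x|.
Proof.
elim: s => [|p s [L L0 IH]]; first by exists 0.
exists (L + n%:R * `|zvec R p.1|); first by rewrite addr_ge0 ?mulr_ge0.
move=> q x y; rewrite inE mulrDl => /orP[/eqP->|/IH qs].
  by apply: le_trans (zaffine_lipschitz _ _ _) _; rewrite lerDr mulr_ge0.
by apply: le_trans (qs x y) _; rewrite lerDl !mulr_ge0.
Qed.

Lemma regular_continuous f : regular_on setT f -> continuous f.
Proof.
move=> /regular_onP fr x; have [s fs] := fr x I.
have [L L0 Ls] := zaffines_lipschitz s.
apply/(@cvgrPdist_le _ _ _ (nbhs (x : 'rV[R]_n))) => e e0.
have L1 : 0 < L + 1 by rewrite ltr_wpDl.
have [fxle [q qs fxE]] := nbhs_singleton fs.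
move/nearPnorm: fs => [d d0 fs].
apply: (@nearPnorm R 'rV[R]_n x _).2; exists (Num.min d (e / (L + 1))).
  by rewrite lt_min d0 divr_gt0.
move=> y; rewrite lt_min => /andP[/fs [fyle [r rs fyE]]].
rewrite ltr_pdivlMr // => ye; have Ly : L * `|y - x| <= e.
  by have := normr_ge0 (y - x); nra.
rewrite ler_norml; apply/andP; split.
  by have := Ls _ x y rs; have := fxle _ rs; rewrite fyE; lra.
by have := Ls _ y x qs; have := fyle _ qs; rewrite fxE distrC; lra.
Qed.

Definition subgradient f x (a : 'rV[int]_n) : Prop :=
  forall y, f x + dot (zvec R a) (y - x) <= f y.

(** On all of R^n this is equivalent to regularity, by [regular_supported] and [supported_regular].
    Being global, it passes directly to attained maxima of infinitely many affine functions, such as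
    [theta_basis]. *)
Definition supported f : Prop := forall x, exists a, subgradient f x a.

Lemma regular_local_support f x : regular_on setT f ->
  exists a : 'rV[int]_n, \forall y \near x, f x + dot (zvec R a) (y - x) <= f y.
Proof.
move=> /regular_onP /(_ x I)[s fs]; have [_ [q qs fE]] := nbhs_singleton fs.
exists q.1; apply: filterS fs => y [/(_ q qs) qle _].
by move: qle; rewrite fE /zaffine dotBr; lra.
Qed.

(* The chord from x to y is compared with f; a small quadratic perturbation
   makes the comparison strict at an interior maximum. *)
Lemma local_support_global f x a : regular_on setT f ->
  (\forall y \near x, f x + dot (zvec R a) (y - x) <= f y) -> subgradient f x a.
Proof.
move=> fr fx y; rewrite leNgt; apply/negP => fy.
pose c (t : R) := x + t *: (y - x).
pose s0 := dot (zvec R a) (y - x).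
(* Half the excess of the slope [s0] over that of the chord: [k] vanishes at 0 and 1, yet is at
   least [e t] just after 0, so its maximum is positive and interior. *)
pose e := (s0 - (f y - f x)) / 2.
have e0 : 0 < e by rewrite /e /s0; lra.
pose k (t : R) := f (c t) - f x - t * (f y - f x) + e * (t ^+ 2 - t).
have c_cont : continuous c.
  move=> t; apply: cvgD; first exact: cvg_cst.
  by apply: cvgZr_tmp; exact: cvg_id.
have k_cont : {within `[0, 1], continuous k}.
  apply: continuous_subspaceT => t.
  apply: cvgD; first apply: cvgB; first apply: cvgB.
  - apply: (@continuous_comp _ _ _ c f); first exact: c_cont.
    exact: regular_continuous.
  - exact: cvg_cst.
  - by apply: cvgMr_tmp; exact: cvg_id.
  - by apply: cvgMl_tmp; apply: cvgB; [apply: exprn_continuous|exact: cvg_id].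
have [t0 t01 k_max] := EVT_max ler01 k_cont.
have c0 : c 0 = x by rewrite /c scale0r addr0.
have c1 : c 1 = y by rewrite /c scale1r addrC subrK.
have k0 : k 0 = 0 by rewrite /k c0; ring.
have k1 : k 1 = 0 by rewrite /k c1; ring.
have kpos : 0 < k t0.
  have /near_segment[d d0 dP] : \forall z \near x + 0 *: (y - x),
      f x + dot (zvec R a) (z - x) <= f z by rewrite scale0r addr0.
  pose t := Num.min (d / 2) 1.
  have t_gt0 : 0 < t by rewrite lt_min ltr01 divr_gt0.
  have t_le1 : t <= 1 by rewrite ge_min lexx orbT.
  have td : `|t - 0| < d.
    rewrite subr0 gtr0_norm //; apply: (@le_lt_trans _ _ (d / 2)); last by lra.
    by rewrite ge_min lexx.
  have := dP _ td; rewrite -/(c t) {2}/c addrAC subrr add0r dotZr -/s0 => ft.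
  apply: (@lt_le_trans _ _ (k t)); last first.
    by apply: k_max; rewrite in_itv /= (ltW t_gt0) t_le1.
  have : s0 = 2 * e + (f y - f x) by rewrite /e; field.
  by rewrite /k => s0E; rewrite s0E in ft; nra.
have t0_gt0 : 0 < t0.
  move: t01; rewrite in_itv /= => /andP[t00 _]; rewrite lt_neqAle t00 andbT.
  by apply/eqP => t0E; move: kpos; rewrite -t0E k0 ltxx.
have t0_lt1 : t0 < 1.
  move: t01; rewrite in_itv /= => /andP[_ t01]; rewrite lt_neqAle t01 andbT.
  by apply/eqP => t0E; move: kpos; rewrite t0E k1 ltxx.
have [b /near_segment[d d0 dP]] := regular_local_support (c t0) fr.
pose sg := dot (zvec R b) (y - x).
have local t : `|t - t0| < d -> f (c t0) + (t - t0) * sg <= f (c t).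
  move=> /dP; rewrite -/(c t); congr (_ + _ <= _).
  by rewrite /c opprD addrACA subrr add0r -scalerBl dotZr.
pose h := Num.min (d / 2) (Num.min t0 (1 - t0)).
have h_gt0 : 0 < h by rewrite !lt_min t0_gt0 subr_gt0 t0_lt1 divr_gt0.
have hd : h < d.
  by apply: (@le_lt_trans _ _ (d / 2)); [rewrite ge_min lexx|lra].
have [ht0 h1] : h <= t0 /\ h <= 1 - t0.
  by split; rewrite !ge_min lexx ?orbT.
(* The slope at [t0] of the lower bound that the local support gives for [k]. A step of length [h]
   in the direction of its sign increases [k] by at least [e h^2], against maximality. *)
pose w := sg - (f y - f x) + e * (2 * t0 - 1).
have contra t : `|t - t0| = h -> 0 <= t <= 1 -> 0 <= w * (t - t0) -> False.
  move=> th t01' wt; have /local ft : `|t - t0| < d by rewrite th.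
  have := k_max t; rewrite in_itv /= t01' => /(_ isT).
  have h2 : h ^+ 2 = (t - t0) ^+ 2 by rewrite -th real_normK ?num_real.
  have kE : k t - k t0 =
      f (c t) - f (c t0) - (t - t0) * sg + w * (t - t0) + e * h ^+ 2.
    by rewrite h2 /k /w; ring.
  have : 0 < e * h ^+ 2 by rewrite mulr_gt0 // exprn_gt0.
  by lra.
have plus : t0 + h - t0 = h by ring.
have minus : t0 - h - t0 = - h by ring.
have [w0|w0] := leP 0 w.
  apply: (contra (t0 + h)); rewrite ?plus ?gtr0_norm //.
    by apply/andP; split; lra.
  by apply: mulr_ge0; [|exact: ltW].
apply: (contra (t0 - h)); rewrite ?minus ?normrN ?gtr0_norm //.
  by apply/andP; split; lra.
by rewrite mulrN -mulNr mulr_ge0 ?oppr_ge0 // ltW.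
Qed.

Lemma regular_supported f : regular_on setT f -> supported f.
Proof.
move=> fr x; have [a fa] := regular_local_support x fr.
by exists a; apply: local_support_global.
Qed.

Lemma integer_vectors_bounded (N : nat) : exists s : seq 'rV[int]_n,
  forall a, `|zvec R a| <= N%:R -> a \in s.
Proof.
exists [seq \row_i (Posz (h i) - Posz N) | h : {ffun 'I_n -> 'I_(N + N).+1}].
move=> a aN.
have ai i : - Posz N <= a 0 i <= Posz N.
  rewrite -ler_norml -(ler_int R) intr_norm -zvecE.
  exact: le_trans (normr_entry _ _) aN.
apply/mapP; exists [ffun i => inord (absz (a 0 i + Posz N))].
  by rewrite mem_enum.
apply/rowP => i; rewrite mxE ffunE inordK; last by have := ai i; lia.
have /andP[aN1 _] := ai i; rewrite gez0_abs; first by rewrite addrK.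
by lia.
Qed.

(** The inequality is tested at [K e_i] or [- K e_i], for a coordinate [i] where [|a|] is attained.
    Since [K] exceeds [n r] by 1, it gives [f x + |a| <= f y], while a subgradient at 0 bounds [f x]
    from below. *)
Lemma supported_slopes_bounded f : supported f -> forall r : R, exists N : nat,
  forall x a, `|x| <= r -> subgradient f x a -> `|zvec R a| <= N%:R.
Proof.
move=> fs r; have [r0|r0] := leP 0 r; last first.
  by exists 0 => x a xr; have := normr_ge0 x; lra.
have [a0 fa0] := fs 0.
pose K : R := n%:R * r + 1.
pose e i : 'rV[R]_n := delta_mx 0 i.
pose B := \sum_i (`|f (K *: e i)| + `|f (- K *: e i)|).
pose C := B + `|f 0| + n%:R * `|zvec R a0| * r.
have [N CN] : exists N : nat, C <= N%:R.
  exists (Num.trunc `|C|).+1; apply: le_trans (ler_norm _) _.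
  by apply/ltW/truncnS_gt.
exists N => x a xr fa; apply: le_trans CN.
have B0 : 0 <= B by apply: sumr_ge0 => i _; rewrite addr_ge0.
have [->|] := eqVneq `|zvec R a| 0.
  by rewrite !addr_ge0 // !mulr_ge0.
move=> /mx_norm_neq0 [[i0 i] /=]; rewrite (ord1 i0) => aE.
pose y := (if 0 <= zvec R a 0 i then K else - K) *: e i.
have fyB : f y <= B.
  rewrite /B (bigD1 i) //=.
  have : 0 <= \sum_(j < n | j != i) (`|f (K *: e j)| + `|f (- K *: e j)|).
    by apply: sumr_ge0 => j _; rewrite addr_ge0.
  rewrite /y; case: ifP => _.
    by have := ler_norm (f (K *: e i)); have := normr_ge0 (f (- K *: e i)); lra.
  by have := ler_norm (f (- K *: e i)); have := normr_ge0 (f (K *: e i)); lra.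
have K0 : 0 <= K by rewrite /K addr_ge0 // mulr_ge0.
have ay : dot (zvec R a) y = K * `|zvec R a|.
  rewrite [`|_|]aE /y dotZr dot_delta; case: (leP 0 (zvec R a 0 i)) => a_i.
    by rewrite ger0_norm.
  by rewrite ltr0_norm // mulrN mulNr.
have ax := ler_norm (dot (zvec R a) x); have ax' := normr_dot_le (zvec R a) x.
have a0x := ler_norm (- dot (zvec R a0) x); rewrite normrN in a0x.
have a0x' := normr_dot_le (zvec R a0) x.
have xle (v : 'rV[R]_n) : n%:R * `|v| * `|x| <= n%:R * `|v| * r.
  by rewrite ler_wpM2l // mulr_ge0.
have := xle (zvec R a); have := xle (zvec R a0).
have := fa y; have := fa0 x; rewrite subr0 dotBr ay => fx0 fyx xa xa0.
have := ler_norm (- f 0); rewrite normrN => f0.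
have KE : K * `|zvec R a| = n%:R * `|zvec R a| * r + `|zvec R a|.
  by rewrite /K; ring.
by rewrite /C; lra.
Qed.

Lemma supported_bounded f : supported f -> forall r : R, exists B : R,
  forall x, `|x| <= r -> `|f x| <= B.
Proof.
move=> fs r; have [N Nb] := supported_slopes_bounded fs r.
exists (`|f 0| + n%:R * N%:R * `|r|) => x xr.
have bound (a : 'rV[int]_n) (z : 'rV[R]_n) : `|zvec R a| <= N%:R -> `|z| <= r ->
    `|dot (zvec R a) z| <= n%:R * N%:R * `|r|.
  move=> aN zr; apply: le_trans (normr_dot_le _ _) _.
  rewrite -!mulrA ler_wpM2l // ler_pM // (le_trans zr) //.
  exact: ler_norm.
have r0 : 0 <= r by apply: le_trans xr.
have [a fa] := fs x; have [b fb] := fs 0.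
have := bound _ _ (Nb _ _ xr fa) xr.
have n0 : `|0 : 'rV[R]_n| <= r by rewrite normr0.
have := bound _ _ (Nb _ _ n0 fb) xr.
have := fa 0; have := fb x; rewrite subr0 sub0r dotNr.
have := ler_norm (- f 0); have := ler_norm (f 0); rewrite normrN.
rewrite !ler_norml => ? ? ? ? /andP[? ?] /andP[? ?].
by apply/andP; split; lra.
Qed.

(** Near [x0] only finitely many slopes occur as subgradients. Two supporting affine functions with
    the same slope coincide, so each slope contributes one function, based at a point [X a] where it
    supports [f]. *)
Lemma supported_regular f : supported f -> regular_on setT f.
Proof.
move=> fs; apply/regular_onP => x0 _.
have [N Nb] := supported_slopes_bounded fs (`|x0| + 1).
have [L LP] := integer_vectors_bounded N.
have /choice[X XP] : forall a : 'rV[int]_n, exists y : 'rV[R]_n,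
    (exists x, subgradient f x a) -> subgradient f y a.
  move=> a; have [[x xa]|na] := pselect (exists x, subgradient f x a).
    by exists x.
  by exists 0.
exists [seq (a, f (X a) - dot (zvec R a) (X a))
       | a <- L & `[< exists x, subgradient f x a >]].
apply: (@nearPnorm R 'rV[R]_n x0 _).2; exists 1 => // y yx0; split.
  move=> q /mapP[a]; rewrite mem_filter => /andP[/asboolP /XP/(_ y) aX _] ->.
  by move: aX; rewrite /zaffine dotBr /=; lra.
have [a fa] := fs y.
have fXa := XP a (ex_intro _ y fa).
exists (a, f (X a) - dot (zvec R a) (X a)).
  apply/mapP; exists a => //; rewrite mem_filter; apply/andP; split.
    by apply/asboolP; exists y.
  apply/LP/(Nb y) => //.
  rewrite -[y](subrK x0) addrC (le_trans (ler_normD _ _)) // lerD2l.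
  exact: ltW.
have := fXa y; have := fa (X a); rewrite /zaffine !dotBr /= => ? ?.
by apply/eqP; rewrite eq_le; apply/andP; split; lra.
Qed.

Lemma subgradient_near_affine f x a p :
  (\forall y \near x, f y = zaffine p y) -> subgradient f x a -> a = p.1.
Proof.
move=> /nearPnorm[e e0 fp] fa; apply/rowP => i; apply: (@intr_inj R).
rewrite -!zvecE -!dot_delta.
have d0 : 0 < e / 2 by rewrite divr_gt0.
have small (s : R) : `|s| = e / 2 ->
    s * dot (zvec R a) (delta_mx 0 i) <= s * dot (zvec R p.1) (delta_mx 0 i).
  move=> sE; pose y := x + s *: delta_mx 0 i : 'rV[R]_n.
  have ye : `|y - x| < e.
    rewrite /y addrAC subrr add0r normrZ sE.
    by have := normr_delta_le1 (R := R) i; nra.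
  have xe : `|x - x| < e by rewrite subrr normr0.
  have yxE : y - x = s *: delta_mx 0 i by rewrite /y addrAC subrr add0r.
  have := fa y; rewrite (fp _ ye) (fp _ xe) /zaffine yxE /y dotDr !dotZr.
  by lra.
have := small (e / 2); have := small (- (e / 2)).
rewrite normrN gtr0_norm // !mulNr => /(_ erefl) h1 /(_ erefl) h2.
apply/eqP; rewrite eq_le -(ler_pM2l d0) -(ler_pM2l d0 (dot _ _)).
by apply/andP; split; lra.
Qed.

Lemma two_subgradients f x a b : subgradient f x a -> subgradient f x b ->
  a != b -> ~ zaffine_near f x.
Proof.
move=> fa fb /eqP ab [p fp]; apply: ab.
by rewrite (subgradient_near_affine fp fa) (subgradient_near_affine fp fb).
Qed.

(** The pieces are read one by one. A piece exceeding the current one at a point of the ball takes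
    over on a smaller ball around that point; otherwise the current one stays. *)
Lemma regular_affine_ball f x0 (e0 : R) : regular_on setT f -> 0 < e0 ->
  exists (x1 : 'rV[R]_n) (e1 : R) p, [/\ 0 < e1,
    forall y, `|y - x1| < e1 -> `|y - x0| < e0
    & forall y, `|y - x1| < e1 -> f y = zaffine p y].
Proof.
move=> fr e00; have [p [s /nearPnorm[d d0 fE]]] := fr x0 I.
suff main : forall t : seq ('rV[int]_n * R), exists (x1 : 'rV[R]_n) (e1 : R) q,
    [/\ 0 < e1, forall y, `|y - x1| < e1 -> `|y - x0| < Num.min e0 d
    & forall y, `|y - x1| < e1 ->
        \big[Num.max/zaffine p y]_(r <- t) zaffine r y = zaffine q y].
  have [x1 [e1 [q [e10 sub qE]]]] := main s.
  exists x1, e1, q; split=> // y ye; have := sub y ye.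
    by rewrite lt_min => /andP[].
  by rewrite lt_min => /andP[_ /fE ->]; exact: qE.
elim=> [|r t [x1 [e1 [q [e10 sub qE]]]]].
  exists x0, (Num.min e0 d), p; split=> //; first by rewrite lt_min e00.
  by move=> y _; rewrite big_nil.
have [[z ze rz]|nr] := pselect (exists2 z, `|z - x1| < e1 &
    zaffine q z < zaffine r z); last first.
  exists x1, e1, q; split=> // y ye; rewrite big_cons qE //.
  by apply: max_r; rewrite leNgt; apply/negP => ry; apply: nr; exists y.
have [L L0 LP] := zaffines_lipschitz [:: q - r].
pose gap := zaffine r z - zaffine q z.
have gap0 : 0 < gap by rewrite subr_gt0.
have L1 : 0 < L + 1 by rewrite ltr_wpDl.
exists z, (Num.min (e1 - `|z - x1|) (gap / (L + 1))), r.
have close y : `|y - z| < Num.min (e1 - `|z - x1|) (gap / (L + 1)) ->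
    `|y - x1| < e1.
  rewrite lt_min => /andP[yz _]; rewrite -(subrKA z).
  by apply: le_lt_trans (ler_normD _ _) _; lra.
split=> [||y yz].
- by rewrite lt_min subr_gt0 ze divr_gt0.
- by move=> y /close /sub.
rewrite big_cons qE; last exact: close.
apply: max_l; move: yz; rewrite lt_min => /andP[_]; rewrite ltr_pdivlMr // => yz.
have := LP (q - r) z y; rewrite inE eqxx => /(_ isT).
rewrite !zaffineB; have := normr_ge0 (y - z); rewrite /gap in yz; nra.
Qed.

Lemma regular_onD W f g : regular_on W f -> regular_on W g ->
  regular_on W (fun x => f x + g x).
Proof.
move=> /regular_onP fr /regular_onP gr; apply/regular_onP => x Wx.
have [s fs] := fr x Wx; have [t gt] := gr x Wx.
exists [seq q + r | q <- s, r <- t].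
apply: filterS2 fs gt => y [fle [q qs fE]] [gle [r rt gE]]; split.
  by move=> _ /allpairsP[[q' r'] /= [q's r't ->]]; rewrite zaffineD lerD ?fle ?gle.
by exists (q + r); [apply/allpairsP; exists (q, r)|rewrite zaffineD fE gE].
Qed.

Lemma zaffine_regular W p : regular_on W (zaffine p).
Proof.
by move=> x _; exists p, [::]; apply: filterE => y; rewrite big_nil.
Qed.

Lemma regular_near W W' f g : (forall x, W x -> W' x) ->
  (forall x, W x -> \forall y \near x, f y = g y) ->
  regular_on W' g -> regular_on W f.
Proof.
move=> sub fg gr x Wx; have [p [s gE]] := gr x (sub x Wx).
by exists p, s; apply: filterS2 gE (fg x Wx) => y <- ->.
Qed.

Lemma regular_rational W f : regular_on W f -> rational_on W f.
Proof.
move=> fr x Wx; have [p [s fE]] := fr x Wx.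
have : nbhs x (fun y => f y = \big[Num.max/zaffine p y]_(q <- s) zaffine q y).
  exact: fE.
rewrite nbhsE => -[V [Vo Vx] VE].
exists V, f, (zaffine 0); split=> //.
- move=> y Vy; exists p, s; apply: filterS (open_nbhs_nbhs (conj Vo Vy)).
  exact: VE.
- exact: zaffine_regular.
- by move=> y _; rewrite zaffine0 subr0.
Qed.

End Regular.

(** * Lattices and quadratic forms *)

Section Lattice.
Context {R : realType} {n : nat}.
Implicit Types (M : 'M[R]_n) (x y l : 'rV[R]_n).

Lemma lattice0 M : lattice M 0.
Proof. by exists 0 => //; rewrite zvec0 mul0mx. Qed.

Lemma latticeD M x y : lattice M x -> lattice M y -> lattice M (x + y).
Proof.
by move=> [k _ <-] [k' _ <-]; exists (k + k') => //; rewrite zvecD mulmxDl.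
Qed.

Lemma latticeN M x : lattice M x -> lattice M (- x).
Proof. by move=> [k _ <-]; exists (- k) => //; rewrite zvecN mulNmx. Qed.

Lemma latticeB M x y : lattice M x -> lattice M y -> lattice M (x - y).
Proof. by move=> lx ly; apply: latticeD => //; apply: latticeN. Qed.

Lemma normr_mulmx_le x (A : 'M[R]_n) : `|x *m A| <= n%:R * `|x| * `|A|.
Proof.
apply: normr_rV_le => [|j]; first by rewrite !mulr_ge0.
rewrite mxE (le_trans (ler_norm_sum _ _ _)) //.
apply: (@le_trans _ _ (\sum_(i < n) `|x| * `|A|)).
  apply: ler_sum => i _; rewrite normrM ler_pM // ?normr_entry //.
  rewrite [X in _ <= X]mx_normrE.
  exact: (le_bigmax _ (fun ij => `|A ij.1 ij.2|) (i, j)).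
by rewrite sumr_const card_ord -mulrA mulr_natl.
Qed.

Lemma lattice_cobounded M : M \in unitmx -> exists2 C : R, 0 <= C &
  forall x, exists2 l, lattice M l & `|x - l| <= C.
Proof.
move=> Mu; exists (n%:R * 1 * `|M|); first by rewrite !mulr_ge0.
move=> x; pose y := x *m invmx M.
pose k : 'rV[int]_n := \row_i Num.floor (y 0 i).
exists (zvec R k *m M); first by exists k.
have -> : x - zvec R k *m M = (y - zvec R k) *m M by rewrite mulmxBl mulmxKV.
apply: le_trans (normr_mulmx_le _ _) _.
rewrite ler_wpM2r // ler_wpM2l //.
apply: normr_rV_le => // i.
have -> : (y - zvec R k) 0 i = y 0 i - (Num.floor (y 0 i))%:~R.
  by rewrite mxE [X in _ + X]mxE zvecE [X in X%:~R]mxE.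
have /andP[fl fu] := floor_itv (y 0 i).
move: fu; rewrite intrD mulr1z => fu.
by rewrite ler_norml; apply/andP; split; lra.
Qed.

End Lattice.

Section QuadraticForm.
Context {R : realType} {n : nat}.
Variable A : 'M[R]_n.
Local Notation Q := (Qform A).
Hypothesis Qsym : forall x y : 'rV[R]_n, Q x y = Q y x.
Implicit Types (x y z v : 'rV[R]_n).

Lemma QformDl x y z : Q (x + y) z = Q x z + Q y z.
Proof. by rewrite /Qform mulmxDl dotDl. Qed.

Lemma QformDr x y z : Q x (y + z) = Q x y + Q x z.
Proof. by rewrite /Qform dotDr. Qed.

Lemma QformNl x y : Q (- x) y = - Q x y.
Proof. by rewrite /Qform mulNmx dotNl. Qed.

Lemma QformNr x y : Q x (- y) = - Q x y.
Proof. by rewrite /Qform dotNr. Qed.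

Lemma QformZl k x y : Q (k *: x) y = k * Q x y.
Proof. by rewrite /Qform -scalemxAl dotZl. Qed.

Lemma QformZr k x y : Q x (k *: y) = k * Q x y.
Proof. by rewrite /Qform dotZr. Qed.

Definition Qform_lin := (QformDl, QformDr, QformNl, QformNr, QformZl, QformZr).

Lemma Qform_tr : A^T = A.
Proof.
apply/matrixP => i j; have := Qsym (delta_mx 0 j) (delta_mx 0 i).
rewrite /Qform !dot_delta -!rowE !mxE => E.
by rewrite E.
Qed.

Lemma Qform_quadD x y : Q (x + y) (x + y) = Q x x + 2 * Q x y + Q y y.
Proof. by rewrite !Qform_lin (Qsym y x); ring. Qed.

Lemma Qform_quadB x y : Q (x - y) (x - y) = Q x x - 2 * Q x y + Q y y.
Proof. by rewrite !Qform_lin (Qsym y x); ring. Qed.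

Lemma Qform_le x y : `|Q x y| <= n%:R * (n%:R * `|x| * `|A|) * `|y|.
Proof.
apply: le_trans (normr_dot_le _ _) _.
by rewrite ler_wpM2r // ler_wpM2l // normr_mulmx_le.
Qed.

Lemma Qform_ker x y v : x *m A = y *m A -> Q x v = Q y v.
Proof. by rewrite /Qform => ->. Qed.

Lemma Qform_ker_quad x y : x *m A = y *m A -> Q x x = Q y y.
Proof. by move=> xy; rewrite (Qform_ker _ xy) Qsym (Qform_ker _ xy). Qed.

Hypothesis Qpsd : forall x, 0 <= Q x x.

Lemma Qform_Cauchy_Schwarz v w : Q v w ^+ 2 <= Q v v * Q w w.
Proof.
have [w0|w0] := eqVneq (Q w w) 0.
  rewrite w0 mulr0; have h t := Qpsd (v - t *: w).
  have {}h (t : R) : 0 <= Q v v - 2 * t * Q v w.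
    by have := h t; rewrite Qform_quadB !Qform_lin w0; lra.
  have := h ((Q v v + 1) / 2 / Q v w).
  have [->|vw] := eqVneq (Q v w) 0; first by rewrite expr0n.
  by rewrite (_ : _ * _ * _ = Q v v + 1); [lra|field].
have w_gt0 : 0 < Q w w by rewrite lt_neqAle eq_sym w0 Qpsd.
have := Qpsd (Q w w *: v - Q v w *: w).
rewrite Qform_quadB !Qform_lin => h.
have : 0 <= Q w w * (Q v v * Q w w - Q v w ^+ 2) by lra.
by rewrite pmulr_rge0 // subr_ge0.
Qed.

Lemma normr2_le_dot v : `|v| ^+ 2 <= dot v v.
Proof.
have [->|/mx_norm_neq0 [[i0 i] /=]] := eqVneq `|v| 0; first by rewrite expr0n dot_ge0.
rewrite (ord1 i0) => vE; rewrite [`|v|]vE real_normK ?num_real // dotE (bigD1 i) //=.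
by rewrite expr2 lerDl; apply: sumr_ge0 => j _; rewrite -expr2 sqr_ge0.
Qed.

(** A semidefinite form cannot control [v] itself, only its image [w = v A]. As [Q v w = dot w w],
    Cauchy-Schwarz gives [|w|^4 <= Q v v Q w w], and [Q w w <= K |w|^2]. *)
Lemma Qform_coercive : exists2 K : R, 0 < K & forall v, `|v *m A| ^+ 2 <= K * Q v v.
Proof.
exists (n%:R * (n%:R * 1 * `|A|) + 1).
  by rewrite ltr_wpDl // !mulr_ge0.
move=> v; set w := v *m A; set K := _ + 1.
have K0 : 0 <= n%:R * (n%:R * 1 * `|A|) :> R by rewrite !mulr_ge0.
have ww : Q w w <= K * `|w| ^+ 2.
  apply: le_trans (ler_norm _) _; apply: le_trans (Qform_le _ _) _.
  have := sqr_ge0 `|w|; rewrite /K; nra.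
have CS := Qform_Cauchy_Schwarz v w.
rewrite {1}/Qform -/w in CS.
have dw := normr2_le_dot w.
have [->|w0] := eqVneq `|w| 0.
  by rewrite expr0n /= mulr_ge0 ?Qpsd // /K; lra.
have w2 : 0 < `|w| ^+ 2 by rewrite exprn_gt0 // lt_neqAle eq_sym w0 normr_ge0.
have : `|w| ^+ 2 * `|w| ^+ 2 <= (K * Q v v) * `|w| ^+ 2.
  apply: (@le_trans _ _ (dot w w ^+ 2)); first by rewrite expr2 ler_pM // ltW.
  apply: le_trans CS _; have := Qpsd v; nra.
by rewrite ler_pM2r.
Qed.

End QuadraticForm.

Lemma seq_argmin (R : realType) (T : eqType) (s : seq T) (F : T -> R) (x0 : T) :
  x0 \in s -> exists2 x, x \in s & forall y, y \in s -> F x <= F y.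
Proof.
elim: s x0 => // a s IH x0 _; case: s IH => [|b s] IH.
  by exists a; rewrite ?inE // => y; rewrite inE => /eqP ->.
have [x xs xmin] := IH b (mem_head _ _).
have [ax|xa] := leP (F a) (F x).
  exists a; first exact: mem_head.
  by move=> y; rewrite inE => /orP[/eqP ->//|/xmin]; apply: le_trans.
exists x; first by rewrite inE xs orbT.
by move=> y; rewrite inE => /orP[/eqP ->|/xmin //]; exact: ltW.
Qed.

(** * Theta functions *)

Section Theta.
Context {R : realType} {n : nat}.
Variables (M A : 'M[R]_n).
Local Notation Q := (Qform A).
Hypothesis hM : M \in unitmx.
Hypothesis formA : is_form M A.
Implicit Types (x y z l r alpha c : 'rV[R]_n) (T : 'rV[R]_n -> R).

Let Qsym x y : Q x y = Q y x. Proof. exact: formA.1. Qed.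

Lemma form_integral l : lattice M l -> exists z : 'rV[int]_n, l *m A = zvec R z.
Proof.
move=> ll; have /choice[z zP] : forall i : 'I_n, exists k : int,
    Q l (delta_mx 0 i) = k%:~R.
  move=> i; have [k kE] := formA.2 l (delta_mx 0 i) ll.
  by exists k; rewrite -kE /zvec map_delta_mx.
exists (\row_i z i); apply/rowP => i.
by rewrite zvecE mxE -zP /Qform dot_delta.
Qed.

(** Removing the quadratic and linear parts turns quasi-periodicity into invariance under the
    lattice, and theta functions into bounded functions. *)
Definition reduced alpha T x := T x - 2^-1 * Q x x - dot alpha x.

Lemma quasi_periodicP alpha T : quasi_periodic M A alpha T <->
  forall l x, lattice M l -> reduced alpha T (x + l) = reduced alpha T x.
Proof.
split=> h l x ll; have := h l x ll.
  by rewrite /reduced => ->; rewrite Qform_quadD // dotDr (Qsym l x); field.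
rewrite /reduced Qform_quadD // dotDr (Qsym l x) => E.
suff : T (x + l) = reduced alpha T x + 2^-1 * (Q x x + 2 * Q x l + Q l l)
    + (dot alpha x + dot alpha l) by rewrite /reduced => ->; field.
by rewrite /reduced -E; ring.
Qed.

Lemma reduced_bounded alpha T : theta M A alpha T ->
  exists C : R, forall x, `|reduced alpha T x| <= C.
Proof.
move=> [/regular_supported Ts /quasi_periodicP Tq].
have [c c0 cP] := lattice_cobounded hM.
have [B BP] := supported_bounded Ts c.
exists (B + 2^-1 * (n%:R * (n%:R * c * `|A|) * c) + n%:R * `|alpha| * c) => x.
have [l ll lx] := cP x; rewrite -[x](subrK l) Tq // /reduced.
set z := x - l; have zc : `|z| <= c := lx.
have h1 := BP z zc; have h2 := normr_dot_le alpha z; have h3 := Qform_le A z z.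
have h4 : n%:R * `|alpha| * `|z| <= n%:R * `|alpha| * c by rewrite ler_wpM2l ?mulr_ge0.
have h5 : n%:R * (n%:R * `|z| * `|A|) * `|z| <= n%:R * (n%:R * c * `|A|) * c.
  by rewrite ler_pM ?mulr_ge0 // ler_wpM2l // ler_wpM2r // ler_wpM2l.
move: h1 h2 h3; rewrite !ler_norml => /andP[? ?] /andP[? ?] /andP[? ?].
by apply/andP; split; lra.
Qed.

Lemma affine_bound_slope0 (w C : R) : (forall t : R, t * w <= C) -> w = 0.
Proof.
move=> h; apply/eqP/negPn/negP => w0.
by have := h ((C + 1) / w); rewrite divfK //; lra.
Qed.

Lemma quadratic_bound_ge0 (u w C : R) :
  (forall t : R, 0 <= u * t ^+ 2 + w * t + C) -> 0 <= u.
Proof.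
move=> h; rewrite leNgt; apply/negP => u0.
pose t := 1 + (`|w| + `|C|) / - u.
have tE : (t - 1) * - u = `|w| + `|C|.
  by rewrite /t addrAC subrr add0r divfK // oppr_eq0 lt_eqF.
have := h t; have := ler_norm w; have := ler_norm C.
have := normr_ge0 w; have := normr_ge0 C.
have t1 : 1 <= t by rewrite lerDl divr_ge0 ?addr_ge0 ?oppr_ge0 // ltW.
nra.
Qed.

(** The subgradient bounds [T] below by an affine function, and [reduced_bounded] bounds it above by
    a quadratic one. Semidefiniteness of [Q] and the condition on [alpha] both come from this
    comparison. *)
Lemma theta_growth alpha T (a : 'rV[int]_n) : theta M A alpha T ->
  subgradient T 0 a -> exists C : R, forall x,
    0 <= 2^-1 * Q x x + dot (alpha - zvec R a) x + C.
Proof.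
move=> Tt Ta; have [C CP] := reduced_bounded Tt.
exists (C - T 0) => x; have := CP x; have := Ta x.
by rewrite ler_norml /reduced subr0 dotBl => ? /andP[? ?]; lra.
Qed.

Lemma theta_psd alpha T : theta M A alpha T -> forall v, 0 <= Q v v.
Proof.
move=> Tt v; have [a Ta] := regular_supported Tt.1 0.
have [C CP] := theta_growth Tt Ta.
have : 0 <= 2^-1 * Q v v.
  apply: (@quadratic_bound_ge0 _ (dot (alpha - zvec R a) v) C) => t.
  by have := CP (t *: v); rewrite !Qform_lin dotZr expr2; lra.
by rewrite pmulr_rge0.
Qed.

(** The columns of [cokermx A] test membership in the row space of [A]; by symmetry of [A] their
    transposes lie in the kernel of [x |-> x A]. *)
Lemma orthogonal_kernel_image v : (forall x, x *m A = 0 -> dot v x = 0) ->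
  exists r, r *m A = v.
Proof.
move=> h; suff /submxP[r ->] : (v <= A)%MS by exists r.
rewrite submxE; apply/eqP/rowP => j; rewrite [RHS]mxE.
have -> : (v *m cokermx A) 0 j = dot v (col j (cokermx A))^T.
  by rewrite /dot trmxK !mxE; apply: eq_bigr => k _; rewrite !mxE.
apply: h; apply: trmx_inj; rewrite trmx_mul trmxK trmx0 (Qform_tr Qsym).
by rewrite colE mulmxA mulmx_coker mul0mx.
Qed.

(** On the kernel of [A] the quadratic term of [theta_growth] vanishes, and a linear form bounded
    below is zero. *)
Lemma theta_characteristic alpha T (a : 'rV[int]_n) : theta M A alpha T ->
  subgradient T 0 a -> exists r, alpha - zvec R a = r *m A.
Proof.
move=> Tt Ta; have [C CP] := theta_growth Tt Ta.
have [//|r <-] := @orthogonal_kernel_image (alpha - zvec R a); last by exists r.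
move=> x xA; apply: (@affine_bound_slope0 _ C) => t.
have := CP (- t *: x); rewrite !Qform_lin dotZr.
by rewrite /Qform xA dot0l; lra.
Qed.

Lemma theta_translate alpha T (a : 'rV[int]_n) : theta M A alpha T ->
  theta M A (alpha - zvec R a) (fun x => T x - dot (zvec R a) x).
Proof.
move=> [Tr Tq]; split.
  have zr := @zaffine_regular R n setT (- a, 0).
  apply: regular_near (regular_onD Tr zr) => // x _.
  by apply: filterE => y; rewrite /zaffine /= zvecN dotNl addr0.
by move=> l x ll; rewrite Tq // dotBl dotDr; ring.
Qed.

Definition same_class (u v : 'rV[int]_n) : Prop :=
  exists2 l, lattice M l & zvec R u = zvec R v + l *m A.

Lemma same_class_sym (u v : 'rV[int]_n) : same_class u v -> same_class v u.
Proof.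
move=> [l ll uv]; exists (- l); first exact: latticeN.
by rewrite uv mulNmx addrK.
Qed.

Lemma same_class_trans (u v w : 'rV[int]_n) :
  same_class u v -> same_class v w -> same_class u w.
Proof.
move=> [l ll uv] [l' ll' vw]; exists (l' + l); first exact: latticeD.
by rewrite uv vw mulmxDl addrA.
Qed.

(** If [c A] is integral and [l] is a lattice point near [c], then [(c - l) A] is a bounded integral
    vector of the same class; so there are finitely many classes. *)
Lemma representatives_exist :
  exists (m : nat) (B : 'I_m -> 'rV[int]_n), is_representatives M A B.
Proof.
have [C C0 CP] := lattice_cobounded hM.
have [N NP] : exists N : nat, n%:R * C * `|A| <= N%:R.
  exists (Num.trunc `|n%:R * C * `|A| |).+1; apply: le_trans (ler_norm _) _.
  exact/ltW/truncnS_gt.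
have [L LP] := @integer_vectors_bounded R n N.
pose inIm (v : 'rV[int]_n) := exists c : 'rV[R]_n, c *m A = zvec R v.
have reduce v : inIm v -> exists2 u, u \in L & same_class v u.
  move=> [c cv]; have [l ll lc] := CP c.
  have [z zE] := form_integral ll.
  exists (v - z); last by exists l; rewrite // zvecB zE subrK.
  apply: LP; rewrite zvecB -cv -zE -mulmxBl.
  apply: le_trans (normr_mulmx_le _ _) _; apply: le_trans NP.
  by rewrite ler_wpM2r // ler_wpM2l.
(* The chosen member of [L] depends only on the class, since equivalent vectors define equal
   sets. *)
pose rep v := xget 0 [set u | u \in L /\ same_class v u].
have repP v : inIm v -> same_class v (rep v).
  by move=> /reduce[u uL vu]; rewrite /rep; case: xgetP => [w _ []|/(_ u)[]].
have repE u v : same_class u v -> rep u = rep v.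
  move=> uv; congr xget; apply/seteqP; split=> w /= [wL cw]; split=> //.
    exact: same_class_trans (same_class_sym uv) cw.
  exact: same_class_trans uv cw.
have inIm_class u v : inIm u -> same_class u v -> inIm v.
  move=> [c cu] [l _ uv]; exists (c - l).
  by rewrite mulmxBl cu uv addrK.
have repL v : inIm v -> rep v \in L.
  by move=> /reduce[u uL vu]; rewrite /rep; case: xgetP => [w _ []|/(_ u)[]].
pose s := undup [seq rep u | u <- L & `[< inIm u >]].
have memsP u : u \in s -> inIm u /\ rep u = u.
  rewrite mem_undup => /mapP[v]; rewrite mem_filter => /andP[/asboolP vI _] ->.
  split; first exact: inIm_class (repP _ vI).
  by apply/esym/repE; exact: repP.
have rep_s v : inIm v -> rep v \in s.
  move=> vI; rewrite mem_undup; have vr := repP _ vI.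
  apply/mapP; exists (rep v); last exact: repE.
  by rewrite mem_filter repL // andbT; apply/asboolP; exact: inIm_class vr.
exists (size s), (fun j : 'I_(size s) => nth 0 s j); split=> [j|v vI].
  by have [] := memsP _ (mem_nth 0 (ltn_ord j)).
have vs : (index (rep v) s < size s)%N by rewrite index_mem rep_s.
exists (Ordinal vs); split=> [/=|j [l ll vj]].
  by rewrite nth_index ?rep_s //; exact: repP.
apply: val_inj; rewrite /= (@repE v (nth 0 s j)); last by exists l.
have [_ ->] := memsP _ (mem_nth 0 (ltn_ord j)).
by rewrite index_uniq // undup_uniq.
Qed.

(* Up to the factor -1/2, the exponent of the l-th term of [theta_basis]
   after completing the square. *)
Definition shifted_quad r c x l := Q (l + c - r - x) (l + c - r - x).

(** Completing the square: up to a summand depending only on [x] and [r], [theta_basis] is minus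
    half the squared [Q]-distance from [x] to the coset [Lambda + c - r]. *)
Lemma theta_term r (b : 'rV[int]_n) c x l : c *m A = zvec R b ->
  dot (zvec R b + l *m A) x - 2^-1 * Q (l + c - r) (l + c - r) =
  2^-1 * Q x x + dot (r *m A) x - 2^-1 * shifted_quad r c x l.
Proof.
move=> <-; rewrite -mulmxDl addrC /shifted_quad (Qform_quadB Qsym (l + c - r)).
have -> : dot ((c + l) *m A) x = Q (l + c - r) x + Q r x.
  by rewrite -QformDl subrK addrC.
by rewrite -/(Q r x); field.
Qed.

Section Basis.
Hypothesis Qpsd : forall x, 0 <= Q x x.

(** Since [Q] may be degenerate, infinitely many [l] can compete. The value depends on [l] only
    through the integral vector [l A], and coercivity leaves finitely many of these below the value
    at [l = 0]; [g] picks a lattice point for each. *)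
Lemma coset_minimum z : exists2 l, lattice M l &
  forall l', lattice M l' -> Q (l + z) (l + z) <= Q (l' + z) (l' + z).
Proof.
have [K K0 KP] := Qform_coercive Qsym Qpsd.
pose V := Num.sqrt (K * Q z z) + `|z *m A|.
have [N NP] : exists N : nat, V <= N%:R.
  exists (Num.trunc `|V|).+1; apply: le_trans (ler_norm _) _.
  exact/ltW/truncnS_gt.
have [L LP] := @integer_vectors_bounded R n N.
have /choice[g gP] : forall u : 'rV[int]_n, exists l,
    (exists2 l', lattice M l' & l' *m A = zvec R u) ->
    lattice M l /\ l *m A = zvec R u.
  move=> u; have [[l ll lu]|nu] := pselect (exists2 l', lattice M l' & l' *m A = zvec R u).
    by exists l.
  by exists 0.
pose F u := Q (g u + z) (g u + z).
pose s := [seq u <- L | `[< exists2 l', lattice M l' & l' *m A = zvec R u >]].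
have small l : lattice M l -> Q (l + z) (l + z) <= Q z z ->
    exists2 u, u \in s & F u = Q (l + z) (l + z).
  move=> ll lz; have [u lu] := form_integral ll.
  exists u; last first.
    have [|gl gu] := gP u; first by exists l.
    by apply: (Qform_ker_quad Qsym); rewrite !mulmxDl gu lu.
  rewrite mem_filter; apply/andP; split; first by apply/asboolP; exists l.
  apply: LP; rewrite -lu -[l](addrK z) mulmxBl; apply: le_trans NP.
  apply: le_trans (ler_normB _ _) _; rewrite lerD2r.
  rewrite -[X in X <= _]ger0_norm // -sqrtr_sqr ler_wsqrtr //.
  by apply: le_trans (KP _) _; rewrite ler_wpM2l // ltW.
have [|u0 u0s _] := small 0 (lattice0 M); first by rewrite add0r.
have [u us umin] := seq_argmin F u0s.
have [lu _] : lattice M (g u) /\ g u *m A = zvec R u.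
  by apply: gP; move: us; rewrite mem_filter => /andP[/asboolP].
exists (g u) => // l' ll'.
have [h|h] := leP (Q (l' + z) (l' + z)) (Q z z).
  by have [v vs <-] := small l' ll' h; exact: umin.
apply: le_trans (ltW h).
have [|v vs vE] := small 0 (lattice0 M); first by rewrite add0r.
by rewrite add0r in vE; rewrite -vE; exact: umin.
Qed.

Lemma theta_basis_min r (b : 'rV[int]_n) c x : c *m A = zvec R b ->
  exists l, [/\ lattice M l,
    theta_basis M A r b c x =
      2^-1 * Q x x + dot (r *m A) x - 2^-1 * shifted_quad r c x l
    & forall l', lattice M l' -> shifted_quad r c x l <= shifted_quad r c x l'].
Proof.
move=> cb; have [l ll lmin] := coset_minimum (c - r - x).
have lmin' l' : lattice M l' -> shifted_quad r c x l <= shifted_quad r c x l'.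
  by rewrite /shifted_quad -!addrA => /lmin; rewrite !addrA.
exists l; split=> //; rewrite /theta_basis -(theta_term r x l cb).
apply/eqP; rewrite eq_le; apply/andP; split; last first.
  apply: ub_le_sup; last by exists l.
  exists (2^-1 * Q x x + dot (r *m A) x - 2^-1 * shifted_quad r c x l).
  by move=> _ [l' ll' <-]; rewrite (theta_term _ _ _ cb); have := lmin' l' ll'; lra.
apply: ge_sup.
  by exists (dot (zvec R b + l *m A) x - 2^-1 * Q (l + c - r) (l + c - r)), l.
move=> _ [l' ll' <-]; rewrite !(theta_term _ _ _ cb).
by have := lmin' l' ll'; lra.
Qed.

Lemma theta_basis_ge r (b : 'rV[int]_n) c x l : c *m A = zvec R b ->
  lattice M l ->
  dot (zvec R b + l *m A) x - 2^-1 * Q (l + c - r) (l + c - r) <=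
  theta_basis M A r b c x.
Proof.
move=> cb ll; have [l0 [_ -> lmin]] := theta_basis_min r x cb.
by rewrite (theta_term _ _ _ cb); have := lmin l ll; lra.
Qed.

(** A term attaining the maximum at [x] supports the whole maximum, and its slope is [b] modulo
    [q(Lambda)]. Basis functions of different classes thus have different subgradients at any
    point. *)
Lemma theta_basis_subgradient r (b : 'rV[int]_n) c x : c *m A = zvec R b ->
  exists2 a, subgradient (theta_basis M A r b c) x a & same_class a b.
Proof.
move=> cb; have [l [ll lE _]] := theta_basis_min r x cb.
have [u lu] := form_integral ll.
exists (b + u); last by exists l; rewrite // zvecD lu.
move=> y; rewrite lE -(theta_term _ _ _ cb) zvecD -lu dotBr.
by apply: le_trans (theta_basis_ge r y cb ll); lra.
Qed.

Lemma theta_basis_theta r (b : 'rV[int]_n) c : c *m A = zvec R b ->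
  theta M A (r *m A) (theta_basis M A r b c).
Proof.
move=> cb; split.
  apply: supported_regular => x.
  by have [a] := theta_basis_subgradient r x cb; exists a.
apply/quasi_periodicP => l x ll.
have [k [kk kE kmin]] := theta_basis_min r (x + l) cb.
have [h [hh hE hmin]] := theta_basis_min r x cb.
rewrite /reduced kE hE.
have shift z y w : shifted_quad r c (z + y) (w + y) = shifted_quad r c z w.
  rewrite /shifted_quad; have -> // : w + y + c - r - (z + y) = w + c - r - z.
  by apply/rowP => i; rewrite !mxE; ring.
have := kmin _ (latticeD hh ll); rewrite shift => k1.
have := hmin _ (latticeB kk ll).
rewrite -[k in X in _ -> X](subrK l) -(shift x l (k - l)) subrK => k2.
by have -> : shifted_quad r c (x + l) k = shifted_quad r c x h; [lra|ring].
Qed.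

(* By quasi-periodicity T lies above all the lattice translates of one of its
   supporting affine functions; their maximum is t + [theta_basis] for some t. *)
Lemma theta_touch r (m : nat) (B : 'I_m -> 'rV[int]_n) (c : 'I_m -> 'rV[R]_n) T x :
  is_representatives M A B -> (forall j, c j *m A = zvec R (B j)) ->
  theta M A (r *m A) T ->
  exists (j : 'I_m) (t : R), T x = t + theta_basis M A r (B j) (c j) x /\
    forall y, t + theta_basis M A r (B j) (c j) y <= T y.
Proof.
move=> [_ Brep] cB Tt; have [a Ta] := regular_supported Tt.1 x.
(* [a] lies in the image of [A]: along the kernel [T] equals its bounded reduced form, yet lies
   above an affine function of slope [a], so [a] vanishes there. *)
have [|j [[l ll aE] _]] := Brep a.
  have [a0 Ta0] := regular_supported Tt.1 0.
  apply: orthogonal_kernel_image => y yA.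
  have [C CP] := reduced_bounded Tt.
  apply: (@affine_bound_slope0 _ (C - T x + dot (zvec R a) x)) => t.
  have := Ta (t *: y); have := CP (t *: y).
  rewrite /reduced ler_norml !Qform_lin dotBr !dotZr.
  have -> : Q y y = 0 by rewrite /Qform yA dot0l.
  have -> : dot (r *m A) y = 0 by rewrite -/(Q r y) Qsym /Qform yA dot0l.
  by move=> /andP[_ ?] ?; lra.
pose w := l + c j - r.
have adot y : dot (zvec R a) y = Q w y + dot (r *m A) y.
  by rewrite aE -cB -mulmxDl -/(Q r y) -QformDl subrK addrC.
(* Chosen so that the [l]-th term of [t + theta_basis] is the affine function supporting [T] at
   [x]. *)
pose t := T x - dot (zvec R a) x + 2^-1 * Q w w.
have lower y : t + theta_basis M A r (B j) (c j) y <= T y.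
  have [k [kk -> _]] := theta_basis_min r y (cB j).
  have mm := latticeB kk ll; set mu := k - l in mm.
  have := ((quasi_periodicP (r *m A) T).1 Tt.2) mu (y - mu) mm.
  rewrite subrK /reduced => Ty; have := Ta (y - mu); rewrite dotBr => Tymu.
  have -> : shifted_quad r (c j) y k = Q (y - mu - w) (y - mu - w).
    have -> : y - mu - w = - (k + c j - r - y).
      by apply/rowP => i; rewrite /mu /w !mxE; ring.
    by rewrite QformNl QformNr opprK.
  rewrite (Qform_quadB Qsym (y - mu)) (Qsym (y - mu) w) /t.
  by have := adot (y - mu); lra.
exists j, t; split=> //; apply/eqP; rewrite eq_le lower andbT.
have := theta_basis_ge r x (cB j) ll; rewrite -aE -/w /t; lra.
Qed.

End Basis.

End Theta.

(** * Tropical linear algebra *)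

Section TropicalLinearAlgebra.
Context {R : realType}.

Lemma fin_argmax (I : finType) (i0 : I) (P : I -> Prop) (F : I -> R) : P i0 ->
  exists i, P i /\ forall j, P j -> F j <= F i.
Proof.
move=> Pi0; have := @arg_maxP _ _ _ i0 (fun i => `[< P i >]) F (asboolT Pi0).
by case=> i /asboolP Pi iP; exists i; split=> // j Pj; apply/iP/asboolP.
Qed.

Lemma fin_pos_lower_bound (I : finType) (P : I -> Prop) (F : I -> R) :
  (forall i, P i -> 0 < F i) -> exists2 e : R, 0 < e & forall i, P i -> e <= F i.
Proof.
move=> F0; have [[i0 Pi0]|nP] := pselect (exists i, P i); last first.
  by exists 1 => // i Pi; exfalso; apply: nP; exists i.
have [i [Pi iP]] := @fin_argmax _ i0 P (fun i => - F i) Pi0.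
by exists (F i); [exact: F0|move=> j /iP; rewrite lerN2].
Qed.

(* t_j is the tropical minor of [a] without the last row and the j-th column.
   Put row [i] in place of the last row: an optimal permutation of the resulting
   square matrix stays optimal when its two equal rows are exchanged. *)
Lemma tropical_Cramer (m : nat) (a : 'I_m.+1 -> 'I_m.+1 -> R) :
  exists t : 'I_m.+1 -> R, forall i, i != ord_max ->
    exists j j', [/\ j != j', forall k, t k + a i k <= t j + a i j
      & forall k, t k + a i k <= t j' + a i j'].
Proof.
pose W (s : {perm 'I_m.+1}) := \sum_(i | i != ord_max) a i (s i).
have /choice[opt optP] : forall j : 'I_m.+1, exists s : {perm 'I_m.+1},
    s ord_max = j /\ forall s' : {perm 'I_m.+1}, s' ord_max = j -> W s' <= W s.
  move=> j; apply: (@fin_argmax _ (tperm ord_max j)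
    (fun s : {perm _} => s ord_max = j)).
  exact: tpermL.
pose t j := W (opt j); exists t => i0 i0max.
have tW (s : {perm 'I_m.+1}) : W s <= t (s ord_max) by apply: (optP _).2.
have [j [_ jP]] := @fin_argmax _ ord_max (fun=> True) (fun k => t k + a i0 k) I.
pose s := opt j; have sj : s ord_max = j by case: (optP j).
exists j, (s i0); split; [|by move=> k; exact: jP|].
  by rewrite -sj (inj_eq perm_inj) eq_sym.
move=> k; apply: le_trans (jP k _) _ => //.
pose s' := (tperm i0 ord_max * s)%g.
have := tW s'; rewrite {2}/s' permM tpermR => tWs'.
have tj : t j = W s by [].
have E : W s' + a i0 (s i0) = W s + a i0 j.
  rewrite /W !(bigD1 (P := fun i => i != ord_max) i0) //=.
  rewrite {1}/s' permM tpermL sj addrAC [in RHS]addrAC [a i0 j + _]addrC.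
  congr (_ + _); apply: eq_bigr => i /andP[imax ii0].
  by rewrite /s' permM tpermD // eq_sym.
by rewrite tj -E lerD2r.
Qed.

Lemma tropical_dependence (k m : nat) (a : 'I_k -> 'I_m -> R) : (k < m)%N ->
  exists t : 'I_m -> R, forall i, exists j j', [/\ j != j',
    forall l, t l + a i l <= t j + a i j
    & forall l, t l + a i l <= t j' + a i j'].
Proof.
case: m a => // m a km; rewrite ltnS in km.
(* The matrix is made square by zero rows; the given rows avoid the last one, on which
   [tropical_Cramer] says nothing. *)
pose b (i : 'I_m.+1) := if insub (val i) is Some i' then a i' else fun=> 0.
have [t tP] := tropical_Cramer b; exists t => i.
have im : (i < m.+1)%N by rewrite (leq_trans (ltn_ord i)) // ltnW.
have bE : b (Ordinal im) = a i by rewrite /b /= valK.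
have := tP (Ordinal im); rewrite bE; apply.
by rewrite -val_eqE /= neq_ltn (leq_trans (ltn_ord i)).
Qed.

(* A maximum of m lines with distinct slopes has at most m - 1 corners. *)
Lemma corners_bound (m : nat) (w k t : 'I_m -> R) : injective w -> injective t ->
  (0 < m)%N -> exists i, forall j j',
    (forall l, k l + t i * w l <= k j + t i * w j) ->
    (forall l, k l + t i * w l <= k j' + t i * w j') -> j = j'.
Proof.
move=> w_inj t_inj m0; apply/not_existsP => H.
pose top i j := forall l, k l + t i * w l <= k j + t i * w j.
(* [b i] is the steepest line attaining the maximum at [t i]. If every [t i] were a corner, [b]
   would be injective, hence onto; but the line of least slope is never the steepest one at a
   corner. *)
have /choice[b bP] : forall i, exists b, (top i b /\ forall j, top i j -> w j <= w b).
  move=> i; have [j [_ jP]] := @fin_argmax _ (Ordinal m0) (fun=> True)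
    (fun l => k l + t i * w l) I.
  by apply: (@fin_argmax _ j (top i)) => l; exact: jP.
have low i : exists2 j, top i j & w j < w (b i).
  have [_ bmax] := bP i; apply: contrapT => nlow; apply: (H i) => j j' tj tj'.
  have eqb l : top i l -> l = b i.
    move=> tl; apply: w_inj; apply/eqP; rewrite eq_le bmax //= leNgt.
    by apply/negP => lb; apply: nlow; exists l.
  by rewrite (eqb j) // (eqb j').
have b_neq i i' : t i < t i' -> b i <> b i'.
  move=> tii' bE; have [j tj wj] := low i'.
  have [/(_ j) h1 _] := bP i; have h2 := tj (b i').
  by rewrite -bE in h2 wj; nra.
have b_inj : injective b.
  move=> i i' bE; apply: t_inj; apply/eqP/negPn/negP => tn.
  by move: tn; rewrite neq_lt => /orP[/b_neq|/b_neq] //; rewrite bE.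
have [j0 [_ j0P]] := @fin_argmax _ (Ordinal m0) (fun=> True) (fun l => - w l) I.
have [g _ gK] := injF_bij b_inj.
have [j _] := low (g j0); rewrite gK => wj.
by have := j0P j I; rewrite lerN2 leNgt wj.
Qed.

Lemma poly_nonroot (p : {poly R}) : p != 0 -> exists x, p.[x] != 0.
Proof.
move=> p0; apply: contrapT => H.
have := @max_poly_roots _ p [seq i%:R | i <- iota 0 (size p)] p0.
rewrite size_map size_iota ltnn; move=> /(_ _ _)/negP; apply => //.
- apply/allP => x _; apply/negPn/negP => px; apply: H; exists x.
  by rewrite -rootE.
- by rewrite map_inj_uniq ?iota_uniq // => i j /eqP; rewrite eqr_nat => /eqP.
Qed.

(** For [u = (1, x, x^2, ...)], the number [dot (s j - s j') u] is the value at [x] of a nonzero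
    polynomial; [x] is taken outside the roots of the product of all of them. *)
Lemma separating_direction (n m : nat) (s : 'I_m -> 'rV[R]_n) : injective s ->
  exists u, injective (fun j => dot (s j) u).
Proof.
move=> s_inj.
pose p := \prod_(jj : 'I_m * 'I_m | jj.1 != jj.2) rVpoly (s jj.1 - s jj.2).
have p0 : p != 0.
  apply/prodf_neq0 => -[j j'] /= jj'; apply/negP => /eqP E.
  have : s j - s j' = 0 by rewrite -[LHS]rVpolyK E linear0.
  by move/eqP; rewrite subr_eq0 => /eqP/s_inj/eqP; apply/negP.
have [x px] := poly_nonroot p0; exists (\row_i x ^+ i) => j j' /= E.
apply/eqP/negPn/negP => jj'; move/negP: px; apply.
rewrite /p horner_prod (bigD1 (j, j')) //=.
have -> : (rVpoly (s j - s j')).[x] = 0; last by rewrite mul0r.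
rewrite (@horner_coef_wide _ n (rVpoly (s j - s j'))); last exact: size_poly.
transitivity (dot (s j - s j') (\row_i x ^+ i)).
  by rewrite dotE; apply: eq_bigr => i _; rewrite coef_rVpoly_ord; congr (_ * _); rewrite mxE.
by rewrite dotBl E subrr.
Qed.

End TropicalLinearAlgebra.

(** * Tropical linear combinations of functions *)

Section Envelope.
Context {R : realType} {n m : nat}.
Implicit Types (th : 'I_m -> 'rV[R]_n -> R) (t : 'I_m -> R) (T : 'rV[R]_n -> R).

Definition envelope th t T : Prop := forall x,
  (forall j, t j + th j x <= T x) /\ exists j, T x = t j + th j x.

Lemma envelope_exists th t : (0 < m)%N -> exists T, envelope th t T.
Proof.
move=> m0; have /choice[T TP] : forall x, exists v : R,
    (forall j, t j + th j x <= v) /\ exists j, v = t j + th j x; last by exists T.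
move=> x; have [j [_ jP]] :=
  @fin_argmax R _ (Ordinal m0) (fun=> True) (fun j => t j + th j x) I.
by exists (t j + th j x); split; [move=> k; exact: jP|exists j].
Qed.

Lemma envelope_subgradient th t T x j a : envelope th t T ->
  T x = t j + th j x -> subgradient (th j) x a -> subgradient T x a.
Proof.
move=> env TE ja y; apply: le_trans ((env y).1 j).
by rewrite TE -addrA lerD2l.
Qed.

Lemma envelope_theta (M A : 'M[R]_n) alpha th t T :
  (forall j, theta M A alpha (th j)) -> envelope th t T -> theta M A alpha T.
Proof.
move=> tht env; split.
  apply: supported_regular => x; have [_ [j jE]] := env x.
  have [a ja] := regular_supported (tht j).1 x.
  by exists a; apply: envelope_subgradient ja.
move=> l x ll; have [le1 [j jE]] := env x; have [le2 [k kE]] := env (x + l).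
have := le1 k; have := le2 j; rewrite kE jE.
rewrite !((tht _).2 l x ll) => h1 h2; apply/eqP.
by rewrite eq_le; apply/andP; split; lra.
Qed.

Lemma inf_touch (f g : 'rV[R]_n -> R) (t : R) y : (forall x, t + g x <= f x) ->
  f y = t + g y -> inf [set f x - g x | x in setT] = t.
Proof.
move=> le fy; apply/eqP; rewrite eq_le; apply/andP; split.
  have -> : t = f y - g y by rewrite fy addrK.
  apply: ge_inf; last by exists y.
  by exists t => _ [x _ <-]; rewrite lerBrDr.
apply: lb_le_inf; first by exists (f 0 - g 0), 0.
by move=> _ [x _ <-]; rewrite lerBrDr.
Qed.

End Envelope.

Lemma zaffine_lt_near (R : realType) (n : nat) (p q : 'rV[int]_n * R) (x : 'rV[R]_n) :
  zaffine p x < zaffine q x -> \forall y \near x, zaffine p y < zaffine q y.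
Proof.
move=> pq; pose L := n%:R * `|zvec R (p - q).1|.
have L1 : 0 < L + 1 by rewrite ltr_wpDl // mulr_ge0.
have gap : 0 < zaffine q x - zaffine p x by rewrite subr_gt0.
apply: (@nearPnorm R 'rV[R]_n x _).2.
exists ((zaffine q x - zaffine p x) / (L + 1)); first exact: divr_gt0.
move=> y; rewrite ltr_pdivlMr // => yx.
have := zaffine_lipschitz (p - q) x y; rewrite -/L !zaffineB.
by have := normr_ge0 (y - x); nra.
Qed.

Lemma affine_dim_full (R : realType) (m : nat) (S : set 'rV[R]_m)
  (x : 'rV[R]_m) (e : R) :
  e != 0 -> S x -> (forall i, S (x + e *: delta_mx 0 i)) -> affine_dim S = m.
Proof.
move=> e0 Sx Se; apply/eqP; rewrite eqn_leq; apply/andP; split.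
  by apply/bigmax_leqP => i _; rewrite -ltnS.
apply: (@leq_bigmax_cond _ _ _ (@ord_max m)); apply/asboolP.
exists x, e%:M; split=> //.
  by rewrite -row_leq_rank mxrank_unit // unitmxE det_scalar unitfE expf_neq0.
by move=> i; rewrite -scalemx1 linearZ /= row1; exact: Se.
Qed.

(** * Counting points *)

Section Count.
Context {R : realType} {n m : nat}.
Variables (M A : 'M[R]_n) (r : 'rV[R]_n).
Variables (B : 'I_m -> 'rV[int]_n) (c : 'I_m -> 'rV[R]_n).
Hypothesis hM : M \in unitmx.
Hypothesis formA : is_form M A.
Hypothesis Qpsd : forall x, 0 <= Qform A x x.
Hypothesis Brep : is_representatives M A B.
Hypothesis cB : forall j, c j *m A = zvec R (B j).
Local Notation th := (fun j => theta_basis M A r (B j) (c j)).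
Local Notation Gamma := (theta M A (r *m A)).

Let th_theta j : Gamma (th j). Proof. exact: theta_basis_theta. Qed.

Let class_inj a j j' : same_class M A a (B j) -> same_class M A a (B j') -> j = j'.
Proof.
move=> aj aj'; have [|j0 [_ uniq]] := Brep.2 a; last by rewrite -(uniq j) // -(uniq j').
case: aj => l _ ->; rewrite -cB -mulmxDl; by exists (c j + l).
Qed.

(** At each [x] some [s + th j] lies below [T] and touches it at [x]; then [s] is the infimum
    defining the [j]-th coordinate. Hence the coordinates reconstruct [T]. *)
Lemma theta_expand T : Gamma T -> exists2 t : 'I_m -> R,
  envelope th t T & theta_coord M A r B c T = \row_j t j.
Proof.
move=> TG; pose t j := inf [set T x - th j x | x in setT]; exists t => // x.
split=> [j|].
  rewrite -lerBrDr; apply: ge_inf; last by exists x.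
  have [C CP] := reduced_bounded hM formA TG.
  have [D DP] := reduced_bounded hM formA (th_theta j).
  exists (- C - D) => _ [y _ <-]; have := CP y; have := DP y.
  by rewrite !ler_norml /reduced => /andP[? ?] /andP[? ?]; lra.
have [j [s [Tx le]]] := theta_touch hM formA Qpsd x Brep cB TG.
by exists j; rewrite Tx /t (inf_touch le Tx).
Qed.

(** Shrinking balls over all [j] makes every [th j] affine on one ball. Its slope is its only
    subgradient there, so it lies in the class of [B j]; the slopes are then distinct and some
    direction [u] separates them. *)
Lemma generic_line : exists (x0 u : 'rV[R]_n) (p : 'I_m -> 'rV[int]_n * R) (e : R),
  [/\ 0 < e, injective (fun j => dot (zvec R (p j).1) u)
  & forall s : R, `|s| < e -> forall j,
      \forall y \near x0 + s *: u, th j y = zaffine (p j) y].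
Proof.
have balls : forall J : seq 'I_m, exists (x0 : 'rV[R]_n) (e0 : R), 0 < e0 /\
    forall j, j \in J -> exists p, forall y, `|y - x0| < e0 -> th j y = zaffine p y.
  elim=> [|j J [x0 [e0 [e00 JP]]]]; first by exists 0, 1.
  have [x1 [e1 [p [e10 sub pP]]]] := regular_affine_ball x0 (th_theta j).1 e00.
  exists x1, e1; split=> // i; rewrite inE => /orP[/eqP ->|/JP[q qP]].
    by exists p.
  by exists q => y /sub /qP.
have [x0 [e0 [e00 balls0]]] := balls (enum 'I_m).
have /choice[p pP] j : exists p, forall y, `|y - x0| < e0 -> th j y = zaffine p y.
  by apply: balls0; rewrite mem_enum.
have near_p x j : `|x - x0| < e0 -> \forall y \near x, th j y = zaffine (p j) y.
  move=> xe; apply: (@nearPnorm R 'rV[R]_n x _).2.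
  exists (e0 - `|x - x0|) => [|y yx]; first by rewrite subr_gt0.
  apply: pP; rewrite -(subrKA x); apply: le_lt_trans (ler_normD _ _) _; lra.
have p_inj : injective (fun j => zvec R (p j).1).
  move=> j j' /zvec_inj E.
  have x0e : `|x0 - x0| < e0 by rewrite subrr normr0.
  have slope k : same_class M A (p k).1 (B k).
    have [a ka aB] := theta_basis_subgradient formA Qpsd r x0 (cB k).
    by rewrite -(subgradient_near_affine (near_p _ _ x0e) ka).
  by apply: (class_inj (slope j)); rewrite E; exact: slope.
have [u u_inj] := separating_direction p_inj.
have u1 : 0 < `|u| + 1 by rewrite ltr_wpDl.
exists x0, u, p, (e0 / (`|u| + 1)); split=> [||s su j]; first exact: divr_gt0.
  exact: u_inj.
apply: near_p; rewrite addrAC subrr add0r normrZ.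
rewrite ltr_pdivlMr // in su; apply: le_lt_trans su.
by rewrite ler_wpM2l // lerDl.
Qed.

(** At each point two basis functions attain the maximum. Their subgradients in two distinct classes
    are both subgradients of [T], which excludes affineness whatever the position of the points. *)
Lemma few_points (k : nat) (x : 'I_k -> 'rV[R]_n) : (k < m)%N ->
  exists2 T, Gamma T & forall i, ~ zaffine_near T (x i).
Proof.
move=> km; have m0 : (0 < m)%N by apply: leq_ltn_trans km.
have [t tP] := tropical_dependence (fun i j => th j (x i)) km.
have [T TE] := envelope_exists th t m0.
exists T => [|i]; first exact: envelope_theta TE.
have [j [j' [jj' jtop j'top]]] := tP i.
have top l : (forall l', t l' + th l' (x i) <= t l + th l (x i)) ->
    T (x i) = t l + th l (x i).
  move=> h; have [le [l' l'E]] := TE (x i).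
  by apply/eqP; rewrite eq_le le andbT l'E h.
have [a ja aB] := theta_basis_subgradient formA Qpsd r (x i) (cB j).
have [b jb bB] := theta_basis_subgradient formA Qpsd r (x i) (cB j').
apply: (two_subgradients (envelope_subgradient TE (top _ jtop) ja)
  (envelope_subgradient TE (top _ j'top) jb)).
by apply: contra jj' => /eqP ab; apply/eqP/(class_inj aB); rewrite ab.
Qed.

Lemma many_points : (0 < m)%N ->
  exists x : 'I_m -> 'rV[R]_n, forall T, Gamma T ->
    ~ forall i, ~ zaffine_near T (x i).
Proof.
move=> m0; have [x0 [u [p [e [e0 w_inj pP]]]]] := generic_line.
pose s (i : 'I_m) : R := e / m.+1%:R * i%:R.
have m1 : 0 < m.+1%:R :> R by rewrite ltr0n.
have s_small i : `|s i| < e.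
  have im : (i%:R : R) < m.+1%:R by rewrite ltr_nat ltnW // ltnS.
  rewrite ger0_norm ?mulr_ge0 ?divr_ge0 ?(ltW e0) // /s mulrAC.
  by rewrite ltr_pdivrMr // ltr_pM2l.
have s_inj : injective s.
  move=> i j /(mulfI _) => /(_ _)/eqP; rewrite eqr_nat => h.
  by apply/val_inj/eqP/h; rewrite mulf_neq0 ?invr_neq0 // gt_eqF.
exists (fun i => x0 + s i *: u) => T TG nT.
have [t tE _] := theta_expand TG.
have [i iP] := corners_bound (fun j => t j + zaffine (p j) x0) w_inj s_inj m0.
have val j : t j + th j (x0 + s i *: u) =
    t j + zaffine (p j) x0 + s i * dot (zvec R (p j).1) u.
  rewrite (nbhs_singleton (pP _ (s_small i) j)) /zaffine dotDr dotZr; ring.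
have [le [j jE]] := tE (x0 + s i *: u).
have jtop l : t l + zaffine (p l) x0 + s i * dot (zvec R (p l).1) u <=
    t j + zaffine (p j) x0 + s i * dot (zvec R (p j).1) u.
  by rewrite -!val -jE.
apply: (nT i); exists ((p j).1, (p j).2 + t j).
have shift k y : zaffine ((p k).1, (p k).2 + t k) y = t k + zaffine (p k) y.
  by rewrite /zaffine /=; ring.
(* Only line [j] is maximal at this point, so the strict inequalities persist nearby and [T] is
   affine there. *)
have others k : k != j -> \forall y \near x0 + s i *: u,
    zaffine ((p k).1, (p k).2 + t k) y < zaffine ((p j).1, (p j).2 + t j) y.
  move=> kj; apply: zaffine_lt_near; rewrite !shift.
  rewrite -!(nbhs_singleton (pP _ (s_small i) _)) -jE lt_neqAle le andbT.
  apply: contra kj => /eqP kE; apply/eqP/iP => // l.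
  by rewrite -!val kE.
have others' : \forall y \near x0 + s i *: u, forall k, k != j ->
    zaffine ((p k).1, (p k).2 + t k) y < zaffine ((p j).1, (p j).2 + t j) y.
  apply: (@filter_forall _ _ (fun k y => k != j -> zaffine ((p k).1, (p k).2 + t k) y <
    zaffine ((p j).1, (p j).2 + t j) y) (nbhs (x0 + s i *: u))) => k.
  have [->|kj] := eqVneq k j; first exact: filterE.
  by apply: filterS (others k kj).
have thE : \forall y \near x0 + s i *: u, forall k, th k y = zaffine (p k) y.
  apply: (@filter_forall _ _ (fun k y => th k y = zaffine (p k) y)
    (nbhs (x0 + s i *: u))) => k.
  exact: pP.
apply: filterS2 others' thE => y oth thy; have [ley [k kE]] := tE y.
rewrite shift -thy; have [<-//|kj] := eqVneq k j.
have := oth k kj; rewrite !shift -!thy -kE => lt.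
by have := ley j; rewrite leNgt lt.
Qed.

Lemma affine_dim_theta_coord : (0 < m)%N ->
  affine_dim (theta_coord M A r B c @` Gamma) = m.
Proof.
move=> m0; have [x0 [u [p [e [e0 w_inj pP]]]]] := generic_line.
pose w j := dot (zvec R (p j).1) u.
have [d d0 dP] : exists2 d : R, 0 < d & forall j, `|d * w j| < e.
  have S1 : 0 < \sum_j `|w j| + 1 by rewrite ltr_wpDl // sumr_ge0.
  exists (e / (\sum_j `|w j| + 1)) => [|j]; first exact: divr_gt0.
  rewrite normrM gtr0_norm ?divr_gt0 // mulrAC ltr_pdivrMr // ltr_pM2l //.
  rewrite (bigD1 j) //= -addrA ltrDl ltr_wpDl // sumr_ge0 //.
have gpos (jj : 'I_m * 'I_m) : jj.1 != jj.2 -> 0 < d / 2 * (w jj.1 - w jj.2) ^+ 2.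
  move=> jj12; rewrite mulr_gt0 ?divr_gt0 // exprn_even_gt0 //=.
  by rewrite subr_eq0; apply: contra jj12 => /eqP/w_inj ->.
have [g g0 gP] := fin_pos_lower_bound gpos.
have thE j k : th k (x0 + (d * w j) *: u) = zaffine (p k) x0 + d * w j * w k.
  rewrite (nbhs_singleton (pP _ (dP j) k)) /zaffine dotDr dotZr -/(w k); ring.
(* In the parameter [s] of the segment, this makes line [j] the tangent at [s = d w_j] to the
   parabola [s^2 / (2 d)]. There it exceeds any other line [k] by [d (w_j - w_k)^2 / 2], which is at
   least [g]. *)
pose t0 j := - (d / 2 * w j ^+ 2) - zaffine (p j) x0.
(* Within this margin line [j] is still maximal at its tangency point, so the [j]-th coordinate of
   the envelope is exactly [t j]. *)
have inS t : (forall j k, j != k -> t k <= t j + (t0 k - t0 j) + g) ->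
    (theta_coord M A r B c @` Gamma) (\row_j t j).
  move=> tP; have [T TE] := envelope_exists th t m0.
  exists T; first exact: envelope_theta TE.
  apply/rowP => j; rewrite !mxE.
  apply: (@inf_touch _ _ _ _ _ (x0 + (d * w j) *: u)) => [x|].
    by case: (TE x) => + _; apply.
  have [le [k kE]] := TE (x0 + (d * w j) *: u).
  apply/eqP; rewrite eq_le le andbT kE !thE.
  have [<-//|jk] := eqVneq j k.
  have := gP (j, k) jk; have := tP j k jk; rewrite /t0 /=; lra.
pose x1 := \row_j t0 j.
apply: (@affine_dim_full _ _ _ x1 g); first by rewrite gt_eqF.
  by apply: inS => j k _; lra.
move=> i; have -> : x1 + g *: delta_mx 0 i = \row_j (t0 j + g * (j == i)%:R).
  by apply/rowP => j; rewrite !mxE eqxx.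
apply: inS => j k _.
by case: (j == i); case: (k == i) => /=; lra.
Qed.

End Count.

(** * Divisors on the torus *)

Section ZaffineNear.
Context {R : realType} {n : nat}.
Implicit Types (f g : 'rV[R]_n -> R) (x l : 'rV[R]_n).

Lemma zaffine_near_ext f g x : (\forall y \near x, f y = g y) ->
  zaffine_near g x -> zaffine_near f x.
Proof. by move=> fg [p gp]; exists p; apply: filterS2 fg gp => y ->. Qed.

Lemma zaffine_nearD f g x : zaffine_near f x -> zaffine_near g x ->
  zaffine_near (fun y => f y + g y) x.
Proof.
move=> [p fp] [q gq]; exists (p + q).
by apply: filterS2 fp gq => y -> ->; rewrite zaffineD.
Qed.

Lemma zaffine_nearB f g x : zaffine_near f x -> zaffine_near g x ->
  zaffine_near (fun y => f y - g y) x.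
Proof.
move=> [p fp] [q gq]; exists (p - q).
by apply: filterS2 fp gq => y -> ->; rewrite zaffineB.
Qed.

Lemma near_translate (P : 'rV[R]_n -> Prop) x l :
  (\forall y \near x + l, P y) -> \forall y \near x, P (y + l).
Proof.
move=> /(@nearPnorm R 'rV[R]_n)[e e0 eP].
apply: (@nearPnorm R 'rV[R]_n x _).2; exists e => // y yx; apply: eP.
by rewrite opprD addrACA subrr addr0.
Qed.

Lemma zaffine_near_translate f x l : zaffine_near f (x + l) ->
  zaffine_near (fun y => f (y + l)) x.
Proof.
move=> [p /near_translate fp]; exists (p.1, p.2 + dot (zvec R p.1) l).
by apply: filterS fp => y ->; rewrite zaffine_shift.
Qed.

(** The pair representing the germ is unique, so it is locally constant in the point, hence
    constant. *)
Lemma zaffine_on_setT f : zaffine_on setT f -> exists p, forall x, f x = zaffine p x.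
Proof.
move=> fa; have /choice[p pP] : forall x, exists p, \forall y \near x, f y = zaffine p y.
  by move=> x; exact: fa.
exists (p 0) => x.
rewrite (@locally_constant_global R 'rV[R]_n _ p _ 0 x) ?(nbhs_singleton (pP x)) //.
move=> y; have /nbhs_interior : nbhs y (fun z => f z = zaffine (p y) z) := pP y.
apply: filterS => z fz; apply: (@zaffine_near_inj R n _ _ z).
by apply: filterS2 fz (pP z) => w <- <-.
Qed.

Lemma regular_on_zaffineD W f g : regular_on W g ->
  (forall x, W x -> zaffine_near (fun y => f y - g y) x) -> regular_on W f.
Proof.
move=> gr fg x Wx; have [p fp] := fg x Wx.
have W1 : regular_on [set x] g by move=> _ ->; exact: gr.
have h := regular_onD W1 (@zaffine_regular R n [set x] p).
apply: (regular_near (fun _ => id) _ h) => // y ->.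
by apply: filterS fp => z <-; rewrite addrC subrK.
Qed.

Lemma open_zaffine_near f : open (zaffine_near f).
Proof.
rewrite openE => x [p fp]; have /nbhs_interior : nbhs x (fun z => f z = zaffine p z) := fp.
by apply: filterS => y fy; exists p.
Qed.

End ZaffineNear.

Section TorusProjection.
Context {R : realType} {n : nat} (M : 'M[R]_n).
Implicit Types (x y l : 'rV[R]_n).

Lemma torus_projP x y : torus_proj M x = torus_proj M y <-> lattice M (y - x).
Proof.
split=> [/(@eqmodP _ (lattice_equiv M))/asboolP //|xy].
by apply/(@eqmodP _ (lattice_equiv M))/asboolP.
Qed.

Lemma torus_projD x l : lattice M l -> torus_proj M (x + l) = torus_proj M x.
Proof. by move=> ll; apply/esym/torus_projP; rewrite addrAC subrr add0r. Qed.

Lemma torus_proj_repr (p : torus M) : torus_proj M (repr p) = p.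
Proof. exact: reprK. Qed.

Lemma torus_repr_proj x : exists2 l, lattice M l & repr (torus_proj M x) = x + l.
Proof.
exists (repr (torus_proj M x) - x); last by rewrite addrC subrK.
by apply/torus_projP; rewrite torus_proj_repr.
Qed.

Lemma open_preimage_torus_proj (U : set (torus M)) :
  open U <-> open (torus_proj M @^-1` U).
Proof. by []. Qed.

End TorusProjection.

(** * Pulling a divisor back to R^n and presenting its line bundle *)

Section Pullback.
Context {R : realType} {n : nat} (M : 'M[R]_n) (D : local_data M).
Hypothesis hD : is_divisor D.
Local Notation proj := (torus_proj M).

Lemma divisor_pullback : exists F : 'rV[R]_n -> R, rational_on setT F /\
  forall i : idx D, zaffine_on (proj @^-1` dom i) (fun x => F x - fn i (proj x)).
Proof.
have [Dopen Dcover Drat Dtrans] := hD.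
have /choice[ch chP] : forall x : 'rV[R]_n, exists i : idx D, dom i (proj x).
  by move=> x; exact: Dcover.
pose U (i : idx D) : set 'rV[R]_n := proj @^-1` dom i.
have diff i j x : U i x -> U j x -> exists p : 'rV[int]_n * R,
    \forall y \near x, fn i (proj y) - fn j (proj y) = zaffine p y.
  by move=> Ui Uj; have [p] := Dtrans i j x (conj Ui Uj); exists p.
(* [s i x] records the germ at [x] of [f_i] minus the function of the chart chosen at [x]. As [ch]
   is arbitrary, [s i] alone need not be locally constant; [s i - s j] is, being the germ of
   [f_i - f_j]. *)
have /choice[s sP] : forall i, exists s : 'rV[R]_n -> 'rV[int]_n * R, forall x, U i x ->
    \forall y \near x, fn i (proj y) - fn (ch x) (proj y) = zaffine (s x) y.
  move=> i; suff /choice[s sP] : forall x, exists p : 'rV[int]_n * R, U i x ->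
      \forall y \near x, fn i (proj y) - fn (ch x) (proj y) = zaffine p y by exists s.
  move=> x; have [Ui|nU] := pselect (U i x); last by exists 0.
  by have [p pP] := diff i (ch x) x Ui (chP x); exists p.
have sdiff i j x (p : 'rV[int]_n * R) : U i x -> U j x ->
    (\forall y \near x, fn i (proj y) - fn j (proj y) = zaffine p y) ->
    s i x - s j x = p.
  move=> Ui Uj pP; apply: (@zaffine_near_inj R n _ _ x).
  apply: filterS3 pP (sP i x Ui) (sP j x Uj) => y <-; rewrite zaffineB => <- <-.
  by rewrite opprB addrA subrK.
have U_open i : open (U i) by exact: Dopen.
have U_near i x : U i x -> \forall y \near x, U i y.
  by move=> Ui; exact: open_nbhs_nbhs.
have s_loc i j (x : 'rV[R]_n) : U i x -> U j x ->
    \forall y \near x, s i y - s j y = s i x - s j x.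
  move=> Ui Uj; have [p pP] := diff i j x Ui Uj.
  have /nbhs_interior pint :
    nbhs x (fun y => fn i (proj y) - fn j (proj y) = zaffine p y) := pP.
  apply: filterS3 pint (U_near i x Ui) (U_near j x Uj) => y py Uiy Ujy.
  by rewrite (sdiff i j x p) // (sdiff i j y p).
have [g gP] := @torsor_trivial R 'rV[R]_n _ _ U s U_open
  (fun x => ex_intro _ (ch x) (chP x)) s_loc.
(* The correction cancels the choice of chart: on [U i] the difference [F - f_i] is given by the
   locally constant pair [g - s i]. *)
pose F x := fn (ch x) (proj x) + zaffine (g x) x.
have FP i : zaffine_on (U i) (fun x => F x - fn i (proj x)).
  move=> x Ui; exists (g x - s i x).
  apply: filterS2 (gP i x Ui) (U_near i x Ui) => y <- Uiy.
  rewrite /F zaffineB -(nbhs_singleton (sP i y Uiy)); ring.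
exists F; split=> // x _.
have [V [f1 [f2 [Vo Vx f1r f2r fE]]]] := Drat (ch x) x (chP x).
exists (V `&` U (ch x)), (fun y => f1 y + (F y - fn (ch x) (proj y))), f2.
split=> //.
- exact: openI.
- by split=> //; exact: chP.
- apply: regular_onD; first by move=> y [Vy _]; exact: f1r.
  move=> y [_ Uy]; have [p pP] := FP _ y Uy; exists p, [::].
  by apply: filterS pP => z ->; rewrite big_nil.
- by move=> y [Vy _]; exact: f2r.
- by move=> y [Vy _]; have := fE y Vy => /= ->; ring.
Qed.

End Pullback.

Lemma additive_int_row (R : realType) (n : nat) (W : lmodType R) (f : 'rV[int]_n -> W) :
  (forall k k', f (k + k') = f k + f k') ->
  forall k, f k = \sum_i (k 0 i)%:~R *: f (delta_mx 0 i).
Proof.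
move=> fD; have f0 : f 0 = 0 by apply: (addrI (f 0)); rewrite -fD !addr0.
have fN k : f (- k) = - f k.
  by apply/eqP; rewrite -addr_eq0 -fD addrC subrr f0.
have fMn k (m : nat) : f (k *+ m) = f k *+ m.
  by elim: m => [|m IH]; rewrite ?mulr0n // !mulrS fD IH.
have fZ (z : int) k : f (z *: k) = z%:~R *: f k.
  rewrite scaler_int -[z in LHS]intz scaler_int.
  by case: z => m; [exact: fMn|rewrite !NegzE !mulrNz fN fMn].
move=> k; rewrite {1}[k]row_sum_delta.
by rewrite (big_morph f fD f0); apply: eq_bigr => i _; rewrite fZ.
Qed.

Section Presentation.
Context {R : realType} {n : nat} (M : 'M[R]_n) (D : local_data M).
Hypothesis hM : M \in unitmx.
Hypothesis hD : is_divisor D.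
Local Notation proj := (torus_proj M).

(** [F (x + l) - F x] is Z-affine in [x]. Its slope is additive in [l] and defines [A]; its
    constant, once the quadratic part is removed, is additive too and defines [alpha]. *)
Lemma presentation_exists : exists A alpha, is_form M A /\ bundle_iso D A alpha.
Proof.
have [F [Frat FP]] := divisor_pullback hD; have [_ Dcover _ _] := hD.
pose la (k : 'rV[int]_n) : 'rV[R]_n := zvec R k *m M.
have laD k k' : la (k + k') = la k + la k' by rewrite /la zvecD mulmxDl.
have la_lattice k : lattice M (la k) by exists k.
have /choice[p pP] : forall k, exists p, forall x, F (x + la k) - F x = zaffine p x.
  move=> k; apply: zaffine_on_setT => x _.
  have [i ix] := Dcover (proj x).
  have ixl : (proj @^-1` dom i) (x + la k) by rewrite /= torus_projD.
  have := zaffine_nearB (zaffine_near_translate (FP i _ ixl)) (FP i x ix).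
  apply: zaffine_near_ext; apply: filterE => y.
  by rewrite torus_projD //; ring.
have pD k k' : p (k + k') =
    ((p k).1 + (p k').1, (p k).2 + (p k').2 + dot (zvec R (p k').1) (la k)).
  apply: (@zaffine_near_inj R n _ _ 0); apply: filterE => x.
  have -> : zaffine (p (k + k')) x = zaffine (p k') (x + la k) + zaffine (p k) x.
    by rewrite -!pP laD addrA subrKA.
  by rewrite zaffine_shift /zaffine /= zvecD dotDl; ring.
pose N : 'M[R]_n := \matrix_(i, j) zvec R (p (delta_mx 0 i)).1 0 j.
have pN k : zvec R (p k).1 = zvec R k *m N.
  rewrite (@additive_int_row R n _ (fun k => zvec R (p k).1)); last first.
    by move=> k1 k2; rewrite pD /= zvecD.
  apply/rowP => j; rewrite summxE mxE; apply: eq_bigr => i _.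
  by rewrite [LHS]mxE [N i j]mxE [zvec R k 0 i]mxE.
pose A := invmx M *m N.
have laA k : la k *m A = zvec R (p k).1 by rewrite /la /A -mulmxA mulKVmx // pN.
(* The constants of [p (k + k')] and [p (k' + k)] are equal, and their expansions differ only in the
   mixed term. *)
have dot_sym k k' : dot (zvec R (p k).1) (la k') = dot (zvec R (p k').1) (la k).
  have := pD k' k; rewrite addrC pD => /(congr1 snd) /=.
  by rewrite [(p k').2 + _]addrC => /addrI.
have laE i : la (delta_mx 0 i) = row i M.
  by rewrite /la /zvec map_delta_mx -rowE.
have S_sym : M *m A *m M^T = (M *m A *m M^T)^T.
  have SE i j : (M *m A *m M^T) i j =
      dot (zvec R (p (delta_mx 0 i)).1) (la (delta_mx 0 j)).
    rewrite -laA !laE -row_mul /dot -!row_mul.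
    by rewrite !mxE; apply: eq_bigr => l _; rewrite !mxE.
  by apply/matrixP => i j; rewrite [RHS]mxE !SE.
have A_sym : A^T = A.
  rewrite [(M *m A *m M^T)^T]trmx_mul trmxK [(M *m A)^T]trmx_mul mulmxA in S_sym.
  have MA : M *m A = M *m A^T.
    by rewrite -[LHS](@mulmxK _ _ _ M^T) ?unitmx_tr // S_sym mulmxK ?unitmx_tr.
  by rewrite -[LHS](mulKmx hM) -MA mulKmx.
have Qsym x y : Qform A x y = Qform A y x.
  by rewrite /Qform dot_mulmx A_sym dotC.
pose c' k := (p k).2 - 2^-1 * Qform A (la k) (la k).
have c'D k k' : c' (k + k') = c' k + c' k'.
  have QE : Qform A (la k) (la k') = dot (zvec R (p k').1) (la k).
    by rewrite /Qform laA dot_sym.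
  by rewrite /c' laD (Qform_quadD Qsym) pD /= QE; field.
pose beta := \row_i c' (delta_mx 0 i) : 'rV[R]_n.
pose alpha := beta *m (invmx M)^T.
have c'E k : c' k = dot alpha (la k).
  rewrite /alpha /la dot_mulmx trmxK mulmxK // dotE.
  rewrite (@additive_int_row R n R^o c' c'D); apply: eq_bigr => i _.
  by rewrite zvecE [beta 0 i]mxE [LHS]mulrC.
exists A, alpha; split; first split=> //.
  move=> _ m [k _ <-]; rewrite /Qform -/(la k) laA.
  exists (\sum_i (p k).1 0 i * m 0 i); rewrite dotE rmorph_sum.
  by apply: eq_bigr => i _; rewrite !zvecE rmorphM.
exists F; split=> // _ x [k _ <-]; rewrite -/(la k) -c'E /c'.
have := pP k x; rewrite /zaffine /Qform laA => E.
by rewrite -[F (x + la k)](subrK (F x)) E; ring.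
Qed.

End Presentation.

(** * The linear system of D and theta functions *)

Section LinearSystem.
Context {R : realType} {n : nat} (M : 'M[R]_n) (D : local_data M).
Variables (A : 'M[R]_n) (alpha : 'rV[R]_n).
Hypothesis hD : is_divisor D.
Hypothesis formA : is_form M A.
Hypothesis DA : bundle_iso D A alpha.
Local Notation proj := (torus_proj M).

Lemma zaffine_near_quasi_periodic T x l : quasi_periodic M A alpha T ->
  lattice M l -> zaffine_near T (x + l) -> zaffine_near T x.
Proof.
move=> Tq ll /zaffine_near_translate Tl; have [z zE] := form_integral formA ll.
pose q : 'rV[int]_n * R := (z, 2^-1 * Qform A l l + dot alpha l).
have qa : zaffine_near (zaffine q) x by exists q; exact: filterE.
apply: zaffine_near_ext (zaffine_nearB Tl qa); apply: filterE => y.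
by rewrite (Tq l y ll) /zaffine /q /= -zE /Qform; ring.
Qed.

Lemma div_supportP (E : local_data M) T x : is_divisor E ->
  quasi_periodic M A alpha T ->
  (forall i : idx E, zaffine_on (proj @^-1` dom i) (fun x => T x - fn i (proj x))) ->
  div_support E (proj x) <-> ~ zaffine_near T x.
Proof.
move=> [Eopen Ecover _ _] Tq TE; split; last first.
  move=> Tx; have [i ix] := Ecover (proj x); exists i; split=> // -[U [_ Ux Ua]].
  apply: Tx; apply: zaffine_near_ext (zaffine_nearD (TE i x ix) (Ua x Ux)).
  by apply: filterE => y /=; rewrite subrK.
move=> [i [ix nU]] Tx; apply: nU.
(* The support is defined by open sets of the torus; the affine locus of [T] is invariant under the
   lattice and descends to [V]. *)
pose V : set (torus M) := [set p | zaffine_near T (repr p)].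
have VE : proj @^-1` V = zaffine_near T.
  apply/seteqP; split=> y; have [l ll] := torus_repr_proj M y; rewrite /V /= => ->.
    exact: zaffine_near_quasi_periodic.
  move=> Ty; apply: (@zaffine_near_quasi_periodic _ _ (- l)) => //.
    exact: latticeN.
  by rewrite addrK.
exists (V `&` dom i); split.
- apply: openI => //; apply/open_preimage_torus_proj; rewrite VE.
  exact: open_zaffine_near.
- by split=> //; change ((proj @^-1` V) x); rewrite VE.
move=> y [Vy iy]; have Ty : zaffine_near T y by rewrite -VE.
apply: zaffine_near_ext (zaffine_nearB Ty (TE i y iy)).
by apply: filterE => z /=; ring.
Qed.

Lemma theta_divisor T : theta M A alpha T -> exists E : local_data M,
  complete_linear_system D E /\
  forall x, div_support E (proj x) <-> ~ zaffine_near T x.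
Proof.
move=> [Tr Tq]; have [F [Frat Fq FP]] := DA.
have [Dopen Dcover Drat Dtrans] := hD.
(* [T] and [F] have the same quasi-periodicity, so [T - F] is periodic and any representative gives
   its value. *)
pose h (p : torus M) := T (repr p) - F (repr p).
have hE x : h (proj x) = T x - F x.
  have [l ll] := torus_repr_proj M x; rewrite /h => ->.
  by rewrite (Tq l x ll) (Fq l x ll); ring.
pose E := LocalData (@dom _ _ _ D) (fun i p => fn i p + h p).
have TE (i : idx E) :
    zaffine_on (proj @^-1` dom i) (fun x => T x - fn i (proj x)).
  move=> x ix; apply: zaffine_near_ext (FP i x ix).
  by apply: filterE => y /=; rewrite hE; ring.
have Ereg (i : idx E) : torus_regular_on (dom i) (fn i).
  apply: regular_on_zaffineD (_ : regular_on _ T) _ => [x _|x ix]; first exact: Tr.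
  have z0 : zaffine_near (fun=> 0) x.
    by exists 0; apply: filterE => y; rewrite zaffine0.
  apply: zaffine_near_ext (zaffine_nearB z0 (TE i x ix)).
  by apply: filterE => y /=; ring.
have Etrans (i j : idx E) :
    torus_zaffine_on (dom i `&` dom j) (fun p => fn i p - fn j p).
  move=> x ijx; apply: zaffine_near_ext (Dtrans i j x ijx).
  by apply: filterE => y /=; ring.
have Ediv : is_divisor E.
  by split=> // i; apply: regular_rational; exact: Ereg.
exists E; split; last by move=> x; exact: div_supportP.
split=> //; first by exists E.
exists h.
  move=> x _; have [V [f1 [f2 [Vo Vx f1r f2r FE]]]] := Frat x I.
  exists V, (fun y => T y + f2 y), f1; split=> //.
    by apply: regular_onD => // y _; exact: Tr.
  by move=> y Vy /=; rewrite hE FE //; ring.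
move=> [i j] [] x [ijx _]; apply: zaffine_near_ext (Dtrans i j x ijx).
by apply: filterE => y /=; ring.
Qed.

(** A divisor equivalent to [D] through [h] is that of [T = F + h], which differs from the regular
    local functions of [E'] by Z-affine ones and is therefore regular. *)
Lemma divisor_theta (E : local_data M) : complete_linear_system D E ->
  exists2 T, theta M A alpha T &
  forall x, div_support E (proj x) <-> ~ zaffine_near T x.
Proof.
move=> [Ediv [E' [[_ E'cover _ _] EE' E'reg]] [h _ hP]].
have [F [Frat Fq FP]] := DA; have [_ Dcover _ _] := hD.
pose T x := F x + h (proj x).
have Tq : quasi_periodic M A alpha T.
  by move=> l x ll; rewrite /T Fq // torus_projD //; ring.
have TE (i : idx E) : zaffine_on (proj @^-1` dom i) (fun x => T x - fn i (proj x)).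
  move=> x ix; have [j jx] := Dcover (proj x).
  have := zaffine_nearB (FP j x jx) (hP (i, j) tt x (conj (conj ix jx) I)).
  by apply: zaffine_near_ext; apply: filterE => y /=; rewrite /T; ring.
exists T; last by move=> x; exact: div_supportP.
split=> // x _; have [k kx] := E'cover (proj x).
have [_ Ecover _ _] := Ediv; have [i ix] := Ecover (proj x).
have gr : regular_on [set x] (fn k \o proj) by move=> _ ->; exact: E'reg.
apply: (regular_on_zaffineD gr) => // _ ->.
have := zaffine_nearD (TE i x ix) (EE' i k x (conj ix kx)).
by apply: zaffine_near_ext; apply: filterE => y /=; ring.
Qed.

Lemma avoidable_theta k : avoidable D k <-> exists x : 'I_k -> 'rV[R]_n,
  forall T, theta M A alpha T -> ~ forall i, ~ zaffine_near T (x i).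
Proof.
split=> [[p pP]|[x xP]].
  exists (fun i => repr (p i)) => T /theta_divisor[E [DE ET]] nT.
  by apply: (pP E DE) => i; rewrite -(torus_proj_repr (p i)); apply/ET/nT.
exists (fun i => proj (x i)) => E /divisor_theta[T TG ET] nE.
by apply: (xP T TG) => i; apply/ET/nE.
Qed.

End LinearSystem.

(** * Comparison of the two numbers *)

Lemma h0_eq (R : realType) (n : nat) (M : 'M[R]_n) (D : local_data M) (k : nat) :
  avoidable D k -> (forall k', (k' < k)%N -> ~ avoidable D k') -> h0 D = Some k.
Proof.
move=> Dk kmin; rewrite /h0; case: pselect => [ex|[]]; last by exists k.
case: ex_minnP => m /asboolP Dm mmin; congr Some; apply/eqP.
rewrite eqn_leq mmin /=; last exact/asboolP.
by rewrite leqNgt; apply/negP => /kmin.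
Qed.

(** The presentation and the choices of [r], [B] and [c] are arbitrary here, so the dimension does
    not depend on them. *)
Lemma dim_Gamma_h0 (R : realType) (n : nat) (M : 'M[R]_n) (D : local_data M)
  (d : nat) : M \in unitmx -> is_divisor D -> dim_Gamma D d -> h0 D = Some d.
Proof.
move=> hM hD [A [alpha [formA DA [[G0 ->]|]]]].
  (* Without theta functions |D| is empty, and already the empty family of points is avoided. *)
  apply: h0_eq => //; apply/(avoidable_theta hD formA DA).
  by exists (fun=> 0) => T TG; rewrite G0 in TG.
move=> [[T TG] [r [m [B [c [alphaE Brep cB ->]]]]]].
rewrite alphaE in DA TG *; have Qpsd := theta_psd hM formA TG.
have m0 : (0 < m)%N.
  by have [[j jm] _] := theta_touch hM formA Qpsd 0 Brep cB TG; apply: leq_ltn_trans jm.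
rewrite (affine_dim_theta_coord _ formA Qpsd Brep cB) //.
apply: h0_eq => [|k km].
  apply/(avoidable_theta hD formA DA).
  exact: (many_points r hM formA Qpsd Brep cB m0).
move=> /(avoidable_theta hD formA DA)[x xP].
have [S SG nS] := few_points r formA Qpsd Brep cB x km.
exact: xP SG nS.
Qed.

(** A subgradient [a] at 0 of some theta function brings [alpha] to the form [r A] after subtracting
    [a]; in the presentation, [F] gives way to [F] minus the linear form [a]. *)
Lemma dim_Gamma_exists (R : realType) (n : nat) (M : 'M[R]_n) (D : local_data M) :
  M \in unitmx -> is_divisor D -> exists d, dim_Gamma D d.
Proof.
move=> hM hD; have [A [alpha [formA DA]]] := presentation_exists hM hD.
have [G0|/set0P[T TG]] := eqVneq (theta M A alpha) set0.
  by exists 0%N, A, alpha; split=> //; left.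
have [a Ta] := regular_supported TG.1 0.
have [r rE] := theta_characteristic hM formA TG Ta.
have [m [B Brep]] := representatives_exist hM formA.
have /choice[c cB] := Brep.1.
exists (affine_dim (theta_coord M A r B c @` theta M A (alpha - zvec R a))).
exists A, (alpha - zvec R a); split=> //.
  have [F [Frat Fq FP]] := DA.
  have za x : zaffine_near (zaffine (a, 0 : R)) x by exists (a, 0); exact: filterE.
  exists (fun x => F x - zaffine (a, 0) x); split.
  - move=> x _; have [V [f1 [f2 [Vo Vx f1r f2r FE]]]] := Frat x I.
    exists V, f1, (fun y => f2 y + zaffine (a, 0) y); split=> //.
      by apply: regular_onD => //; exact: zaffine_regular.
    by move=> y Vy; rewrite FE //; ring.
  - by move=> l x ll; rewrite Fq // /zaffine /= dotDr dotBl; ring.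
  move=> i x ix; apply: zaffine_near_ext (zaffine_nearB (FP i x ix) (za x)).
  by apply: filterE => y; ring.
right; split; last by exists r, m, B, c.
by exists (fun x => T x - dot (zvec R a) x); exact: theta_translate.
Qed.

Theorem theorem3 (R : realType) (n : nat) (M : 'M[R]_n)
    (hM : M \in unitmx) (D : local_data M) (hD : is_divisor D) :
  exists d : nat,
    h0 D = Some d /\ (forall d' : nat, dim_Gamma D d' <-> d' = d).
Proof.
have [d Dd] := dim_Gamma_exists hM hD; have hd := dim_Gamma_h0 hM hD Dd.
exists d; split=> // d'; split=> [/(dim_Gamma_h0 hM hD)|-> //].
by rewrite hd => -[].
Qed.
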